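(* Let $C_0,C_1,C_2$ be the constants of the following fact: for the Square-Root SLOPE estimator $\hat\beta$ (with $A\ge16+4\sqrt2$), for all $\delta\in(0,1]$ and $n_1>\frac{C_0}{\delta^2}s\log(\frac{ep}{s})$, $\sup_{|\beta|_0\le s}\mathbf P_\beta(\|\hat\beta-\beta\|\ge\delta\sigma)\le C_1(\frac{s}{2p})^{C_2s}$. Let $s$ be an integer with $s\le p/2$, $\delta\in(0,1]$, and let $\hat\eta$ be the selector defined below with threshold $t=t_{\sigma\sqrt{1+\delta^2}}$. Then for all $n_1>\frac{C_0}{\delta^2}s\log(\frac{ep}{s})$, $$\sup_{\beta\in\Omega^p_{s,a}}\mathbf E_\beta|\hat\eta-\eta_\beta|\le2\psi(n_2,p,s,a,\sigma\sqrt{1+\delta^2})+C_1(s/2)^{C_2s}p^{1-C_2s},$$ $$\sup_{\beta\in\Omega^p_{s,a}}\mathbf P_\beta(\hat\eta\neq\eta_\beta)\le2\psi(n_2,p,s,a,\sigma\sqrt{1+\delta^2})+C_1(s/2)^{C_2s}p^{-C_2s}.$$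
   Context: Model: $Y=X\beta+\sigma\xi\in\mathbb{R}^n$, $X\in\mathbb{R}^{n\times p}$ with i.i.d. $\mathcal N(0,1)$ entries, $\xi\sim\mathcal N(0,\mathbb I_n)$ independent of $X$, $\sigma>0$. $\Omega^p_{s,a}=\{\beta\in\mathbb{R}^p:|\beta|_0\le s,\ |\beta_i|\ge a \text{ whenever }\beta_i\ne0\}$, $\eta_\beta=(\mathbf 1\{\beta_i\neq0\})_{i\le p}$, $|\cdot|$ the Hamming distance on $\{0,1\}^p$. The sample is split into disjoint subsamples $(X^{(1)},Y^{(1)})$ of size $n_1$ and $(X^{(2)},Y^{(2)})$ of size $n_2$, $n=n_1+n_2$. $\hat\beta$ is the Square-Root SLOPE estimator on the first subsample: $\hat\beta\in\arg\min_\beta\big(\|Y^{(1)}-X^{(1)}\beta\|/\sqrt{n_1}+2\sum_{j}\lambda_j\beta^*_j\big)$ with $\lambda_j=A\sqrt{\log(2p/j)/n}$ and $\beta^*_1\ge\dots\ge\beta^*_p$ the sorted $|\beta_i|$. The selector: $\hat\eta_i=\mathbf 1\Big\{\frac{|X_i^{(2)\top}(Y^{(2)}-\sum_{j\neq i}X^{(2)}_j\hat\beta_j)|}{\|X^{(2)}_i\|}>t(X^{(2)}_i)\Big\}$, $i=1,\dots,p$, with $X^{(2)}_i$ the $i$th column of $X^{(2)}$. For $\sigma'>0$, $t_{\sigma'}(u)=\frac{a\|u\|}{2}+\frac{\sigma'^2\log(\frac ps-1)}{a\|u\|}$. Define $\psi(m,p,s,a,\sigma')=(p-s)\mathbf P(\sigma'\varepsilon>t_{\sigma'}(\zeta))+s\,\mathbf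 P(\sigma'\varepsilon>(a\|\zeta\|-t_{\sigma'}(\zeta))_+)$ with $\varepsilon\sim\mathcal N(0,1)$, $\zeta\sim\mathcal N(0,\mathbb I_m)$ independent, and $x_+=\max(x,0)$. *)

(* Defs.v *)
From HB Require Import structures.
From mathcomp Require Import all_boot all_order all_algebra.
From mathcomp Require Import all_classical all_reals all_analysis.
From mathcomp Require Import normal_distribution.

Set Implicit Arguments.
Unset Strict Implicit.
Unset Printing Implicit Defensive.

Import Order.TTheory GRing.Theory Num.Theory.
Local Open Scope classical_set_scope.
Local Open Scope ring_scope.

Section Defs.
Variable R : realType.

Definition iid_std_normal {d} {T : measurableType d} (P : probability T R)
    {I : finType} (Z : I -> T -> R) : Prop :=
  (forall i, measurable_fun setT (Z i)) /\
  forall (J : {set I}) (B : I -> set R), (forall i, measurable (B i)) ->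
    P [set w | forall i, i \in J -> B i (Z i w)] =
    (\prod_(i in J) fine (normal_prob 0 1 (B i)))%:E.

Definition norm2 {m : nat} (v : 'cV[R]_m) : R := Num.sqrt (\sum_k v k 0 ^+ 2).

Definition l0 {p : nat} (b : 'cV[R]_p) : nat := #|[set i | b i 0 != 0]|.

Definition eta_supp {p : nat} (b : 'cV[R]_p) (i : 'I_p) : bool := b i 0 != 0.

Definition in_Omega {p : nat} (s : nat) (a : R) (b : 'cV[R]_p) : Prop :=
  (l0 b <= s)%N /\ forall i, b i 0 != 0 -> a <= `|b i 0|.

(** b^*_1 >= ... >= b^*_p : the sorted absolute values (index k = j-1). *)
Definition sorted_abs {p : nat} (b : 'cV[R]_p) : seq R :=
  sort (fun x y : R => y <= x) [seq `|b i 0| | i <- enum 'I_p].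

Definition slope_lambda (A : R) (n p j : nat) : R :=
  A * Num.sqrt (ln (2 * p%:R / j%:R) / n%:R).

(** Square-root SLOPE objective on the first subsample (size n1),
    with tuning lambda_j computed with the total sample size n. *)
Definition sqrt_slope_obj (A : R) (n : nat) {n1 p : nat}
    (X : 'M[R]_(n1, p)) (Y : 'cV[R]_n1) (b : 'cV[R]_p) : R :=
  norm2 (Y - X *m b) / Num.sqrt n1%:R
  + 2 * \sum_(k < p) slope_lambda A n p k.+1 * nth 0 (sorted_abs b) k.

Definition is_sqrt_slope (A : R) (n : nat) {n1 p : nat}
    (est : 'M[R]_(n1, p) -> 'cV[R]_n1 -> 'cV[R]_p) : Prop :=
  forall X Y b, sqrt_slope_obj A n X Y (est X Y) <= sqrt_slope_obj A n X Y b.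

Definition threshold (sig' a : R) (p s : nat) {m : nat} (u : 'cV[R]_m) : R :=
  a * norm2 u / 2 + sig' ^+ 2 * ln (p%:R / s%:R - 1) / (a * norm2 u).

Definition selector (sig' a : R) (s : nat) {n2 p : nat}
    (X2 : 'M[R]_(n2, p)) (Y2 : 'cV[R]_n2) (bh : 'cV[R]_p) (i : 'I_p) : bool :=
  threshold sig' a p s (col i X2) <
  `| ((col i X2)^T *m (Y2 - \sum_(j < p | j != i) (bh j 0 *: col j X2))) 0 0 |
    / norm2 (col i X2).

Definition eps_zeta {T : Type} {m : nat} (eps : T -> R) (zeta : 'I_m -> T -> R)
    (k : option 'I_m) : T -> R :=
  match k with None => eps | Some k => zeta k end.

(** psi(m,p,s,a,sigma'), computed with eps ~ N(0,1), zeta ~ N(0,I_m)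
    independent, living on the probability space Q. *)
Definition psi_of {d} {T : measurableType d} (Q : probability T R) {m : nat}
    (eps : T -> R) (zeta : 'I_m -> T -> R) (p s : nat) (a sig' : R) : R :=
  let zv w := \col_k zeta k w in
  (p - s)%:R * fine (Q [set w | threshold sig' a p s (zv w) < sig' * eps w])
  + s%:R * fine (Q [set w | Num.max (a * norm2 (zv w) - threshold sig' a p s (zv w)) 0
                            < sig' * eps w]).

Definition data_family {T : Type} {n1 n2 p : nat}
    (X1 : T -> 'M[R]_(n1, p)) (xi1 : T -> 'cV[R]_n1)
    (X2 : T -> 'M[R]_(n2, p)) (xi2 : T -> 'cV[R]_n2)
    (k : ('I_n1 * 'I_p + 'I_n1) + ('I_n2 * 'I_p + 'I_n2)) : T -> R :=
  match k with
  | inl (inl ij) => fun w => X1 w ij.1 ij.2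
  | inl (inr i) => fun w => xi1 w i 0
  | inr (inl ij) => fun w => X2 w ij.1 ij.2
  | inr (inr i) => fun w => xi2 w i 0
  end.

End Defs.

(* Main.v *)
(** Conditionally on the first subsample and on the column [X2_i], the statistic of the
    selector is [b_i |X2_i|] plus a centred normal variable of variance
    [sigma^2 + sum_(j != i) (b_j - bhat_j)^2], which is smaller than [sigma'^2] as soon as
    [|bhat - b| < delta sigma]. Hence each coordinate errs with probability at most twice
    the corresponding tail in [psi], and the complementary event is controlled by the
    assumed bound on the estimator.

    The estimator is an arbitrary minimizer, and only its composition with the data is
    assumed measurable, which does not make it independent of the second subsample. One
    therefore needs the minimizer to be almost surely unique. On each of the finitely many
    cones on which the sorted penalty is linear, multiplying one generator column of the
    design by [1/t] makes the value function concave in [t], and its derivative is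
    determined by the corresponding coordinate of the minimizer; two minimizers thus produce
    a kink, and a concave function has few kinks. As Gaussian null sets are preserved by the
    scaling, the set of designs with a kink is null. Two minimizers in different cones are
    joined by a segment of minimizers, two of which share a cone. A unique minimizer is a
    Borel function of the data, by compactness. *)
Require Import Defs.
From HB Require Import structures.
From mathcomp Require Import all_boot all_order all_algebra fingroup perm.
From mathcomp Require Import all_classical all_reals all_analysis.
From mathcomp Require Import normal_distribution measurable_realfun.
From mathcomp Require Import ring lra.
Import Order.TTheory GRing.Theory Num.Theory.
Local Open Scope classical_set_scope.
Local Open Scope ring_scope.

Set Implicit Arguments.
Unset Strict Implicit.
Unset Printing Implicit Defensive.

(** * Independent standard normal families *)

(** The sigma-algebra of [T] may be richer than the one generated by the data, so measurability of
    [w => bhat (X1 w) ...] on [T] does not make [bhat] a Borel function of the first subsample, and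
    Tonelli over the two subsamples is available for Borel functions only. Hence the bounds are
    proved for a Borel version and transferred off a null set. Conditional laws never appear as
    objects: a subset of the coordinates is redrawn from an independent copy, and each conditional
    statement becomes an iterated integral. Kinks are indexed by two rational slopes [0 < q1 < q2],
    which makes their union countable, and inequalities at rational times replace derivatives of the
    concave value function. The factor 2 before psi has two sources: for an inactive coordinate the
    two-sided test, for an active one the case where the positive part is 0, in which the tail is
    one half and only the trivial bound 1 is available. *)

Definition rvec (R : realType) (I : finType) : Type := I -> R.

Definition box {R : realType} (I : finType) (B : I -> set R) : set (rvec R I) :=
  [set x | forall i, B i (x i)].

Definition boxes (R : realType) (I : finType) : set (set (rvec R I)) :=
  [set A | exists2 B : I -> set R, (forall i, measurable (B i)) & A = box B].

Definition rvec_display : measure_display. Proof. exact. Qed.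

HB.instance Definition _ (R : realType) (I : finType) := gen_eqMixin (rvec R I).
HB.instance Definition _ (R : realType) (I : finType) := gen_choiceMixin (rvec R I).
HB.instance Definition _ (R : realType) (I : finType) :=
  isPointed.Build (rvec R I) (fun=> 0).
Section rvec_sigma_algebra.
Variables (R : realType) (I : finType).

Let rvec_set0 : <<s @boxes R I >> set0.
Proof. exact: sigma_algebra0. Qed.

Let rvec_setC A : <<s @boxes R I >> A -> <<s @boxes R I >> (~` A).
Proof. by move=> /sigma_algebraCD; rewrite setTD. Qed.

Let rvec_bigcup (F : (set (rvec R I))^nat) :
  (forall i, <<s @boxes R I >> (F i)) -> <<s @boxes R I >> (\bigcup_i F i).
Proof. exact: sigma_algebra_bigcup. Qed.

HB.instance Definition _ := @isMeasurable.Build rvec_display (rvec R I)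
  (<<s @boxes R I >>) rvec_set0 rvec_setC rvec_bigcup.

End rvec_sigma_algebra.

Lemma measurable_preimage d d' (T : measurableType d) (T' : measurableType d')
  (f : T -> T') (A : set T') :
  measurable_fun setT f -> measurable A -> measurable (f @^-1` A).
Proof. by move=> mf mA; rewrite -[X in measurable X]setTI; exact: mf. Qed.

Section rvec_measurable.
Context {R : realType} {I : finType}.

Lemma measurable_box (B : I -> set R) :
  (forall i, measurable (B i)) -> measurable (box B).
Proof. by move=> mB; apply: sub_sigma_algebra; exists B. Qed.

Lemma measurable_coord (i : I) : measurable_fun setT (fun x : rvec R I => x i).
Proof.
move=> _ Y mY; rewrite setTI.
rewrite [X in measurable X](_ : _ = box (fun j => if j == i then Y else setT)).
  by apply: measurable_box => j; case: ifP.
apply/seteqP; split=> x /=; last by move=> /(_ i); rewrite eqxx.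
by move=> Yx j; case: eqP => // ->.
Qed.

Lemma measurable_rvec d (T : measurableType d) (f : T -> rvec R I) :
  (forall i, measurable_fun setT (fun w => f w i)) -> measurable_fun setT f.
Proof.
move=> mf; apply: (@measurability _ _ _ _ _ _ (@boxes R I)) => //.
move=> _ [_ [B mB ->] <-]; rewrite setTI.
rewrite [X in measurable X](_ : _ = \bigcap_(i in [set: I]) ((fun w => f w i) @^-1` B i)).
  apply: fin_bigcap_measurable; first exact: finite_finset.
  by move=> i _; rewrite -[X in measurable X]setTI; exact: mf.
by apply/seteqP; split=> x /= Bx i; [move=> _|]; apply: Bx.
Qed.

End rvec_measurable.

Section iid_family.
Context {R : realType} d (T : measurableType d) (P : probability T R).
Context {I : finType} (Z : I -> T -> R).
Hypothesis iidZ : iid_std_normal P Z.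

Definition joint {I' : Type} (X : I' -> T -> R) (w : T) : I' -> R := X^~ w.

Lemma measurable_joint : measurable_fun setT (joint Z : T -> rvec R I).
Proof. by apply: measurable_rvec => i; exact: iidZ.1. Qed.

Lemma iid_box (B : I -> set R) : (forall i, measurable (B i)) ->
  P (joint Z @^-1` box B) = (\prod_i fine (normal_prob 0 1 (B i)))%:E.
Proof.
move=> mB; have := iidZ.2 [set: I]%SET B mB.
rewrite (eq_bigl xpredT) => [<-|i]; last by rewrite finset.in_setT.
by congr (P _); apply/seteqP; split=> x /= H i => [_|]; apply: H; rewrite ?finset.in_setT.
Qed.

Lemma iid_coord (i : I) (B : set R) : measurable B ->
  P [set w | B (Z i w)] = normal_prob 0 1 B.
Proof.
move=> mB; have := iidZ.2 [set i]%SET (fun=> B) (fun=> mB).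
rewrite big_set1 fineK ?fin_num_measure// => <-.
congr (P _); apply/seteqP; split=> x /=; last by apply; rewrite finset.in_set1.
by move=> Bx j; rewrite finset.in_set1 => /eqP ->.
Qed.

End iid_family.

Local Notation pushm :=
  measure_function_pushforward__canonical__measure_function_Measure.

(** Boxes are stable under intersection and generate the sigma-algebra of [rvec], so the product
    formula on boxes determines the law. This is the only bridge between the data on [P], the
    variables of psi on [Q], and product spaces. *)
Lemma iid_law (R : realType) d (T : measurableType d) (P : probability T R)
    d' (T' : measurableType d') (Q : probability T' R) (I : finType)
    (Z : I -> T -> R) (Z' : I -> T' -> R) :
  iid_std_normal P Z -> iid_std_normal Q Z' ->
  forall A : set (rvec R I), measurable A ->
  P (joint Z @^-1` A) = Q (joint Z' @^-1` A).
Proof.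
move=> iZ iZ' A mA.
apply: (@measure_unique _ R (rvec R I) (@boxes R I) (fun=> setT) _ _ _ _
  (pushm P (measurable_joint iZ)) (pushm Q (measurable_joint iZ'))) => //.
- move=> _ _ [B mB ->] [C mC ->]; exists (fun i => B i `&` C i).
    by move=> i; exact: measurableI.
  by apply/seteqP; split=> x /=; [move=> [xB xC] i; split; [exact: xB|exact: xC]|move=> H; split=> i; case: (H i)].
- move=> _; exists (fun=> setT) => //; by apply/seteqP; split.
- by apply/seteqP; split=> // x _; exists 0%N.
- by move=> _ [B mB ->]; rewrite [LHS](iid_box iZ)// [RHS](iid_box iZ').
- by move=> _; rewrite /= /pushforward preimage_setT probability_setT ltry.
Qed.

Lemma iid_reindex (R : realType) d (T : measurableType d) (P : probability T R)
    (I J : finType) (f : J -> I) (Z : I -> T -> R) : injective f ->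
  iid_std_normal P Z -> iid_std_normal P (Z \o f).
Proof.
move=> injf [mZ pZ]; split=> [j|K B mB]; first exact: mZ.
pose B' i := if [pick j | f j == i] is Some j then B j else setT.
have B'E j : B' (f j) = B j.
  rewrite /B'; case: pickP => [k /eqP/injf ->//|/(_ j)]; by rewrite eqxx.
have := pZ (f @: K)%SET B'; rewrite big_imset/=; last by move=> ? ? _ _ /injf.
under eq_bigr do rewrite B'E; move=> <-.
  congr (P _); apply/seteqP; split=> w /= H.
    by move=> _ /imsetP[j jK ->]; rewrite B'E; exact: H.
  by move=> j jK; rewrite -B'E; apply: H; exact: imset_f.
by move=> i; rewrite /B'; case: pickP => [k _|//].
Qed.

Lemma iid_sum (R : realType) d1 (T1 : measurableType d1) (P1 : probability T1 R)
    d2 (T2 : measurableType d2) (P2 : probability T2 R) (I J : finType)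
    (X : I -> T1 -> R) (Y : J -> T2 -> R) :
  iid_std_normal P1 X -> iid_std_normal P2 Y ->
  iid_std_normal (P1 \x P2)%E (fun (k : I + J) w =>
    match k with inl i => X i w.1 | inr j => Y j w.2 end).
Proof.
move=> [mX pX] [mY pY]; split=> [[i|j]|K B mB].
- exact: measurableT_comp.
- exact: measurableT_comp.
pose KI := [set i | inl i \in K]%SET; pose KJ := [set j | inr j \in K]%SET.
have -> : [set w : T1 * T2 | forall i, i \in K ->
    B i match i with inl i => X i w.1 | inr j => Y j w.2 end] =
    [set w | forall i, i \in KI -> B (inl i) (X i w)] `*`
    [set w | forall j, j \in KJ -> B (inr j) (Y j w)].
  apply/seteqP; split=> -[w1 w2] /=.
    by move=> H; split=> i; rewrite inE => /H.
  by move=> [H1 H2] [i|j] K' //=; [apply: H1|apply: H2]; rewrite inE.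
rewrite [LHS]product_measure1E//.
- rewrite [X in (X * _)%E](pX KI (B \o inl)) ?[X in (_ * X)%E](pY KJ (B \o inr))//=.
  rewrite big_sumType/= EFinM; congr (_%:E * _%:E)%E.
    by apply: eq_bigl => i; rewrite inE.
  by apply: eq_bigl => i; rewrite inE.
- rewrite [X in measurable X](_ : _ =
     \bigcap_(i in [set i | i \in KI]) (X i @^-1` (B (inl i)))).
    apply: fin_bigcap_measurable; first exact: finite_finset.
    by move=> i _; rewrite -[X in measurable X]setTI; exact: mX.
  by apply/seteqP; split=> x.
- rewrite [X in measurable X](_ : _ =
     \bigcap_(i in [set i | i \in KJ]) (Y i @^-1` (B (inr i)))).
    apply: fin_bigcap_measurable; first exact: finite_finset.
    by move=> i _; rewrite -[X in measurable X]setTI; exact: mY.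
  by apply/seteqP; split=> x.
Qed.

Definition mix {R : Type} {I : finType} (S : {set I}) (x y : I -> R) : I -> R :=
  fun i => if i \in S then x i else y i.

(** Substitute for conditioning on the coordinates in [S]: taking those from one copy and the others
    from an independent copy does not change the law, and Tonelli on [P \x P] gives the iterated
    form. *)
Lemma iid_mix (R : realType) d (T : measurableType d) (P : probability T R)
    (I : finType) (S : {set I}) (Z : I -> T -> R) (H : set (rvec R I)) :
  iid_std_normal P Z -> measurable H ->
  P (joint Z @^-1` H) =
  (\int[P]_w P [set w' | H (mix S (joint Z w) (joint Z w'))])%E.
Proof.
move=> iZ mH.
pose f i : I + I := if i \in S then inl i else inr i.
have injf : injective f by rewrite /f => i j; case: ifP; case: ifP => _ _ // [].
rewrite (iid_law iZ (iid_reindex injf (iid_sum iZ iZ)) mH).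
rewrite /= /product_measure1; apply: eq_integral => w _ /=.
congr (P _); rewrite /xsection; apply/seteqP; split=> w' /=; rewrite in_setE /=.
  move=> Hw; rewrite (_ : mix _ _ _ = joint ((fun (k : I + I) (w0 : T * T) =>
    match k with inl i => Z i w0.1 | inr j => Z j w0.2 end) \o f) (w, w'))//.
  by apply/funext => i; rewrite /mix /joint /= /f; case: ifP.
move=> Hw; rewrite (_ : joint _ _ = mix S (joint Z w) (joint Z w'))//.
by apply/funext => i; rewrite /mix /joint /= /f; case: ifP.
Qed.

Section mix_bound.
Context {R : realType} d (T : measurableType d) (P : probability T R)
  {I : finType} (Z : I -> T -> R).
Hypothesis iidZ : iid_std_normal P Z.

Lemma measurable_mix (S : {set I}) (H : set (rvec R I)) : measurable H ->
  measurable_fun setT (fun w => P [set w' | H (mix S (joint Z w) (joint Z w'))]).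
Proof.
move=> mH; pose f (z : T * T) : rvec R I := mix S (joint Z z.1) (joint Z z.2).
have mf : measurable_fun setT f.
  apply: measurable_rvec => e; rewrite /f /mix; case: (e \in S);
    by apply: measurableT_comp => //; exact: iidZ.1.
rewrite (_ : (fun w => _) = P \o xsection (f @^-1` H)).
  by apply: measurable_fun_xsection; exact: measurable_preimage mf mH.
by apply/funext => w /=; congr (P _); apply/seteqP; split=> t; rewrite /xsection /= in_setE.
Qed.

Lemma iid_mix_le (S : {set I}) (H : set (rvec R I)) (q : \bar R) : measurable H ->
  (0 <= q)%E ->
  (forall w, P [set w' | H (mix S (joint Z w) (joint Z w'))] <= q)%E ->
  (P (joint Z @^-1` H) <= q)%E.
Proof.
move=> mH q0 Hq; rewrite (iid_mix S iidZ mH).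
apply: (@le_trans _ _ (\int[P]_w q)%E); last first.
  by rewrite integral_cst// [X in (_ * X)%E]probability_setT mule1.
by apply: ge0_le_integral => //=; exact: measurable_mix.
Qed.

End mix_bound.

(** * Normal laws under affine maps and reflection *)

Local Notation leb := lebesgue_measure.

Section affine.
Context {R : realType}.
Implicit Types (c h : R) (A B : set R).

Definition affine c h (x : R) : R := c * x + h.

Lemma measurable_affine c h :
  measurable_fun [set: R] (affine c h : R -> measurableTypeR R).
Proof. by apply: measurable_funD => //; apply: measurable_funM. Qed.

Lemma lebesgue_affine c h A : 0 < c -> measurable A ->
  leb A = (c%:E * pushforward leb (affine c h : R -> measurableTypeR R) A)%E.
Proof.
move=> c0 mA.
have := @lebesgue_measure_unique R (mscale (NngNum (ltW c0)) (pushm leb (measurable_affine c h))).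
move=> /(_ _ A mA) -> // _ [[a b]] _ <-.
transitivity (c%:E * leb (`]((a - h) / c)%R, ((b - h) / c)%R]%classic))%E; last first.
  rewrite /= /mscale/= /pushforward; congr (_ * leb _)%E.
  by apply/esym;  apply/seteqP; split=> x /=; rewrite !in_itv/= /affine
    ltr_pdivrMr// ler_pdivlMr// ltrBlDr lerBrDr (mulrC x).
rewrite !lebesgue_measure_itv/= !lte_fin ltr_pM2r ?invr_gt0// ltrD2r.
case: ifP => _; last by rewrite mule0.
rewrite -!EFinD -EFinM; congr (_%:E).
by field; rewrite gt_eqF.
Qed.

Lemma ge0_integral_affine c h (f : R -> \bar R) A : 0 < c -> measurable A ->
  measurable_fun setT f -> (forall x, 0 <= f x)%E ->
  (\int[leb]_(x in A) f x = c%:E * \int[leb]_(x in affine c h @^-1` A) f (affine c h x))%E.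
Proof.
move=> c0 mA mf f0.
have := @ge0_integral_pushforward _ _ (measurableTypeR R) (measurableTypeR R) R _ (measurable_affine c h) leb A f mA.
move=> <-//; last exact: measurable_funTS.
apply: etrans (@ge0_integral_mscale _ _ R (pushm leb (measurable_affine c h)) A mA (NngNum (ltW c0)) f _ _) => //.
  by apply: eq_measure_integral => B mB _; exact: lebesgue_affine.
exact: measurable_funTS.
Qed.

Lemma normal_pdf_affine (s c h x : R) : 0 < c -> s != 0 ->
  normal_pdf 0 s x = c * normal_pdf h (c * s) (affine c h x).
Proof.
move=> c0 s0; have cs0 : c * s != 0 by rewrite mulf_neq0// gt_eqF.
rewrite !normal_pdfE// mulrA; congr (_ * _).
  rewrite /normal_peak [in RHS]exprMn -[in RHS]mulrA -[in RHS]mulrnAr.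
  move: (s ^+ 2 * pi *+ 2) => K.
  by rewrite sqrtrM ?sqr_ge0// sqrtr_sqr gtr0_norm// invfM mulVKf// gt_eqF.
rewrite /normal_fun /affine; congr expR; rewrite subr0 addrK exprMn [in RHS]exprMn.
rewrite -[in RHS]mulrnAr !mulNr; congr (- _).
by rewrite -mulf_div divff ?mul1r// expf_neq0// gt_eqF.
Qed.

Lemma normal_prob_affine (s c h : R) B : 0 < c -> s != 0 -> measurable B ->
  normal_prob 0 s (affine c h @^-1` B) = normal_prob h (c * s) B.
Proof.
move=> c0 s0 mB; rewrite /normal_prob.
rewrite [RHS](ge0_integral_affine h c0 mB)//; last 2 first.
- by apply/measurable_EFinP; exact: measurable_normal_pdf.
- by move=> x; rewrite lee_fin normal_pdf_ge0.
have mpre : measurable (affine c h @^-1` B).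
  by rewrite -[X in measurable X]setTI; exact: measurable_affine.
rewrite -ge0_integralZl//; last 3 first.
- apply: measurable_funTS; apply/measurable_EFinP.
  apply: measurableT_comp; first exact: measurable_normal_pdf.
  exact: measurable_affine.
- by move=> x _; rewrite lee_fin normal_pdf_ge0.
- by rewrite lee_fin ltW.
apply: eq_integral => x _; rewrite -EFinM; congr (_%:E).
exact: normal_pdf_affine.
Qed.

Lemma normal_prob_opp (s : R) B : s != 0 -> measurable B ->
  normal_prob 0 s (-%R @^-1` B) = normal_prob 0 s B.
Proof.
move=> s0 mB; rewrite /normal_prob.
have mN : measurable_fun setT (-%R : R -> measurableTypeR R) by [].
rewrite [RHS](_ : _ = \int[pushforward leb (-%R : R -> measurableTypeR R)]_(x in B) (normal_pdf 0 s x)%:E)%E.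
  have -> := @ge0_integral_pushforward _ _ (measurableTypeR R) (measurableTypeR R)
    R _ mN leb B (fun x => (normal_pdf 0 s x)%:E) mB.
  - apply: eq_integral => x _; rewrite /= !normal_pdfE// /normal_fun.
    by rewrite !subr0 sqrrN.
  - apply: measurable_funTS; apply/measurable_EFinP; exact: measurable_normal_pdf.
  - by move=> x _; rewrite lee_fin normal_pdf_ge0.
by apply: eq_measure_integral => A mA _; apply/esym/lebesgue_measureN.
Qed.

(** Coefficients of linear forms may be negative; the sign is absorbed by the symmetry of the
    centred law, whose density involves only the square of [c]. *)
Lemma normal_prob_scale (c : R) B : c != 0 -> measurable B ->
  normal_prob 0 1 [set y | B (c * y)] = normal_prob 0 c B.
Proof.
move=> c0 mB.
have mpre (k : R) : measurable ([set y | B (k * y)]).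
  by rewrite -[X in measurable X]setTI; exact: measurable_funM.
have n1 : (1 : R) != 0 := oner_neq0 R.
have [cp|] := ltP 0 c.
  rewrite -[c in RHS]mulr1 -(@normal_prob_affine 1 c 0) //.
  by congr (normal_prob _ _ _); apply/seteqP; split=> x /=; rewrite /affine addr0.
rewrite le_eqVlt (negbTE c0)/= => cn; rewrite -(normal_prob_opp n1 (mpre c)).
have -> : normal_prob 0 c B = normal_prob 0 (- c * 1) B.
  rewrite /normal_prob; apply: eq_integral => x _.
  by rewrite !normal_pdfE ?mulr1 ?oppr_eq0// /normal_peak /normal_fun !sqrrN.
rewrite -(@normal_prob_affine 1 (- c) 0) ?oppr_gt0//.
by congr (normal_prob _ _ _); apply/seteqP; split=> x /=; rewrite /affine addr0 mulrN mulNr.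
Qed.

End affine.

(** * Integration against a measure given by a density *)

Section density.
Context d (T : measurableType d) (R : realType).
Variables (mu nu : {measure set T -> \bar R}) (g : T -> R).
Hypotheses (mg : measurable_fun setT g) (g0 : forall x, 0 <= g x).
Hypothesis nuE : forall A, measurable A -> nu A = (\int[mu]_(x in A) (g x)%:E)%E.

Import HBNNSimple.

Let integral_density_nnsfun (f : {nnsfun T >-> R}) :
  (\int[nu]_x (f x)%:E = \int[mu]_x ((f x)%:E * (g x)%:E))%E.
Proof.
under [LHS]eq_integral do rewrite fimfunE -fsumEFin//.
rewrite [LHS]ge0_integral_fsum//; last 2 first.
- by move=> r; exact/measurable_EFinP/measurableT_comp.
- by move=> n x _; rewrite EFinM nnfun_muleindic_ge0.
under [RHS]eq_integral.
  move=> x xD; rewrite fimfunE -fsumEFin// ge0_mule_fsuml; last first.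
    by move=> r; rewrite EFinM nnfun_muleindic_ge0.
  over.
rewrite [RHS]ge0_integral_fsum//; last 2 first.
- move=> r; apply: emeasurable_funM; last exact/measurable_EFinP.
  by apply/measurable_EFinP/measurableT_comp.
- move=> n x _; apply: mule_ge0; last by rewrite lee_fin.
  by rewrite EFinM nnfun_muleindic_ge0.
apply: eq_fsbigr => r _; rewrite integralZl_indic_nnsfun//= integral_indic//= setIT nuE//.
have [r0|r0] := leP 0 r.
  rewrite -ge0_integralZl//; last 2 first.
  - by apply: measurable_funTS; exact/measurable_EFinP.
  - by move=> x _; rewrite lee_fin.
  rewrite integral_mkcond; apply: eq_integral => x _.
  rewrite patchE indicE; case: ifPn => xr; first by rewrite mulr1.
  by rewrite mulr0 mul0e.
rewrite preimage_nnfun0// integral_set0 mule0; apply/esym/integral0_eq => x _.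
by rewrite indic0 mulr0 mul0e.
Qed.

Lemma ge0_integral_density (f : T -> \bar R) :
  measurable_fun setT f -> (forall x, 0 <= f x)%E ->
  (\int[nu]_x f x = \int[mu]_x (f x * (g x)%:E))%E.
Proof.
move=> mf f0; pose f_ := nnsfun_approx measurableT mf.
transitivity (limn (fun n => \int[nu]_x (f_ n x)%:E))%E.
  rewrite -monotone_convergence//=.
  - by apply: eq_integral => ? _; apply/esym/cvg_lim => //=; exact: cvg_nnsfun_approx.
  - by move=> n; exact/measurable_EFinP/measurable_funTS.
  - by move=> n ? _; rewrite lee_fin.
  - by move=> ? _ ? ? mn; rewrite lee_fin; exact/lefP/nd_nnsfun_approx.
under eq_fun do rewrite integral_density_nnsfun.
rewrite -monotone_convergence//=.
- apply: eq_integral => x _; apply/cvg_lim => //=.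
  by apply: cvgeZr => //; exact: cvg_nnsfun_approx.
- by move=> n; apply: emeasurable_funM; exact/measurable_EFinP.
- by move=> n x _; rewrite mule_ge0// lee_fin.
- move=> x _ m n mn; apply: lee_wpmul2r; rewrite lee_fin//.
  exact/lefP/nd_nnsfun_approx.
Qed.

End density.

(** * Convolution of centred normal laws *)

Section convolution.
Context {R : realType}.
Implicit Types (a s : R).

(** Completing the square: joint density = marginal density * conditional density. *)
Lemma normal_pdfM (a s v x y : R) : s != 0 -> v ^+ 2 = a ^+ 2 + s ^+ 2 ->
  normal_pdf (a * y) s x * normal_pdf 0 1 y =
  normal_pdf 0 v x * normal_pdf (a * x / v ^+ 2) (s / v) y.
Proof.
move=> s0 v2.
have s2 : 0 < s ^+ 2 by rewrite exprn_even_gt0.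
have v2gt0 : 0 < v ^+ 2 by rewrite v2 ltr_wpDl// sqr_ge0.
have v0 : v != 0 by rewrite -sqrf_eq0 gt_eqF.
rewrite !normal_pdfE ?mulf_neq0 ?invr_eq0 ?oner_neq0//.
rewrite mulrACA [RHS]mulrACA; congr (_ * _).
  rewrite /normal_peak -!invfM; congr (_^-1).
  have pos (t : R) : 0 <= t ^+ 2 * pi *+ 2.
    by rewrite mulrn_wge0// mulr_ge0 ?sqr_ge0// pi_ge0.
  rewrite -!sqrtrM//.
  congr (Num.sqrt _).
  move: {+}pi => Pi; field; exact: v0.
rewrite /normal_fun -!expRD; congr expR.
have -> : (s / v) ^+ 2 = s ^+ 2 / v ^+ 2 by rewrite exprMn exprVn.
have -> : y - a * x / v ^+ 2 = (v ^+ 2 * y - a * x) / v ^+ 2.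
  by field.
rewrite v2; field.
by rewrite s0 -v2 gt_eqF.
Qed.

End convolution.

Section normal_sum.
Context {R : realType}.

Lemma normal_pdf_shift (m s x : R) : s != 0 -> normal_pdf m s x = normal_pdf 0 s (x - m).
Proof. by move=> s0; rewrite !normal_pdfE// /normal_fun subr0. Qed.

(** After the two integrals are exchanged, [normal_pdfM] leaves a normal density in [y], which
    integrates to 1, times the density with parameter [v]. *)
Lemma normal_prob_conv (a s v : R) (B : set R) :
  s != 0 -> v ^+ 2 = a ^+ 2 + s ^+ 2 -> measurable B ->
  (\int[normal_prob 0 1]_y normal_prob 0 s [set x | B (a * y + x)%R] =
   normal_prob 0 v B)%E.
Proof.
move=> s0 v2 mB.
have v0 : v != 0.
  by rewrite -sqrf_eq0 v2 gt_eqF// ltr_wpDl ?sqr_ge0// exprn_even_gt0.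
pose S : set (R * R) := [set z | B (a * z.1 + z.2)].
have mS : measurable S.
  rewrite -[S]setTI; apply: (_ : measurable_fun setT (fun z : R * R => a * z.1 + z.2)) => //.
  by apply: measurable_funD => //; exact: measurable_funM.
rewrite (ge0_integral_density (mu := leb) (measurable_normal_pdf 0 1))//=; last 2 first.
- by move=> x; exact: normal_pdf_ge0.
- rewrite (_ : (fun y => _) = (normal_prob 0 s \o xsection S)).
    exact: measurable_fun_xsection.
  by apply/funext => y /=; congr (normal_prob _ _ _); apply/seteqP; split=> x /=;
    rewrite /xsection /= in_setE.
pose h (z : R * R) := normal_pdf (a * z.1) s z.2 * normal_pdf 0 1 z.1.
have mh : measurable_fun setT h.
  apply: measurable_funM; last exact: (measurableT_comp (measurable_normal_pdf 0 1)).
  rewrite (_ : (fun _ => _) = normal_pdf 0 s \o (fun z : R * R => z.2 - a * z.1)).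
    apply: (measurableT_comp (measurable_normal_pdf 0 s)).
    by apply: measurable_funB => //; exact: measurable_funM.
  by apply/funext => z /=; rewrite normal_pdf_shift.
have h0 z : 0 <= h z by rewrite mulr_ge0// normal_pdf_ge0.
have mBfun : measurable_fun setT (fun z : R * R => (\1_B z.2 : R)).
  by apply: measurableT_comp; [exact: measurable_indic|].
transitivity (\int[leb]_y \int[leb]_x ((\1_B x * h (y, x))%:E))%E.
  apply: eq_integral => y _.
  rewrite (_ : normal_prob 0 s _ = normal_prob (a * y) s B); last first.
    rewrite -[s in RHS]mul1r -normal_prob_affine ?ltr01//.
    by congr (normal_prob _ _ _); apply/seteqP; split=> x /=; rewrite /affine mul1r addrC.
  rewrite /normal_prob -ge0_integralZr//; last 3 first.
  - by apply: measurable_funTS; apply/measurable_EFinP; exact: measurable_normal_pdf.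
  - by move=> x _; rewrite lee_fin normal_pdf_ge0.
  - by rewrite lee_fin normal_pdf_ge0.
  rewrite integral_mkcond; apply: eq_integral => x _.
  by rewrite patchE indicE; case: ifPn => _; rewrite ?mul1r ?mul0r// -EFinM.
have mk : measurable_fun setT (fun z : R * R => (\1_B z.2 * h z)%:E).
  by apply/measurable_EFinP; exact: measurable_funM.
have k0 (z : R * R) : (0 <= (\1_B z.2 * h z)%:E)%E by rewrite lee_fin mulr_ge0.
apply: (etrans (@fubini_tonelli _ _ (measurableTypeR R) (measurableTypeR R) R leb leb _ mk k0)).
rewrite /normal_prob [RHS]integral_mkcond; apply: eq_integral => x _.
transitivity (\int[leb]_y ((\1_B x * normal_pdf 0 v x)%:E *
    (normal_pdf (a * x / v ^+ 2) (s / v) y)%:E))%E.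
  by apply: eq_integral => y _; rewrite /h/= (normal_pdfM _ _ s0 v2) mulrA -EFinM.
rewrite ge0_integralZl//; last 3 first.
- by apply/measurable_EFinP; exact: measurable_normal_pdf.
- by move=> y _; rewrite lee_fin normal_pdf_ge0.
- by rewrite lee_fin mulr_ge0// normal_pdf_ge0.
rewrite integral_normal_pdf mule1 patchE indicE.
by case: ifP => _; rewrite ?mul1r ?mul0r.
Qed.

End normal_sum.

(** * Linear forms in an independent standard normal family *)

Section iid_linear.
Context {R : realType} d (T : measurableType d) (P : probability T R).
Context {I : finType} (Z : I -> T -> R).
Hypothesis iidZ : iid_std_normal P Z.

Lemma iid_coord_integral (i : I) (f : R -> \bar R) :
  measurable_fun setT f -> (forall x, 0 <= f x)%E ->
  (\int[P]_w f (Z i w) = \int[normal_prob 0 1]_y f y)%E.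
Proof.
move=> mf f0.
have mZ : measurable_fun setT (Z i : T -> measurableTypeR R) := iidZ.1 i.
have := @ge0_integral_pushforward _ _ T (measurableTypeR R) R _ mZ P setT f measurableT mf.
rewrite preimage_setT => <-//.
apply: (@eq_measure_integral _ _ _ _ (normal_prob 0 1) (pushm P mZ)) => A mA _.
exact: iid_coord.
Qed.

Lemma measurable_lin (r : seq I) (a : I -> R) :
  measurable_fun setT (fun x : rvec R I => \sum_(i <- r) a i * x i).
Proof.
apply: measurable_sum => i; apply: measurable_funM => //; exact: measurable_coord.
Qed.

Lemma iid_lin (r : seq I) (a : I -> R) (v : R) (B : set R) :
  uniq r -> v != 0 -> v ^+ 2 = \sum_(i <- r) a i ^+ 2 -> measurable B ->
  P [set w | B (\sum_(i <- r) a i * Z i w)] = normal_prob 0 v B.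
Proof.
elim: r v B => [|k r IH] v B.
  by rewrite big_nil => _ v0 /eqP; rewrite sqrf_eq0 (negbTE v0).
rewrite /= big_cons => /andP[kr ur] v0 v2 mB.
set s2 := \sum_(i <- r) a i ^+ 2 in v2.
have s20 : 0 <= s2 by apply: sumr_ge0 => i _; exact: sqr_ge0.
(* The induction hypothesis requires a nonzero standard deviation. If the remaining coefficients all
   vanish, only the first term survives and scaling is enough. *)
have [s2_0|s2_neq0] := eqVneq s2 0.
  have a0 i : i \in r -> a i = 0.
    move=> ir; apply/eqP; rewrite -sqrf_eq0.
    have := s2_0 => /eqP; rewrite /s2 psumr_eq0; last by move=> ? _; exact: sqr_ge0.
    by move=> /allP/(_ _ ir).
  have ak : a k != 0.
    by apply: contraNneq v0 => ak0; rewrite -sqrf_eq0 v2 ak0 s2_0 expr0n/= addr0.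
  have -> : [set w | B (\sum_(i <- k :: r) a i * Z i w)] =
            [set w | [set y | B (a k * y)] (Z k w)].
    apply/seteqP; split=> w /=; rewrite big_cons [X in _ + X]big_seq;
      by under eq_bigr => i ir do rewrite (a0 _ ir) mul0r; rewrite big1// addr0.
  rewrite (iid_coord iidZ); last first.
    by rewrite -[X in measurable X]setTI; exact: measurable_funM.
  rewrite (normal_prob_scale ak mB).
  have -> : a k ^+ 2 = v ^+ 2 -> normal_prob 0 (a k) B = normal_prob 0 v B; last first.
  - by rewrite v2 s2_0 addr0.
  - done.
  move=> av; apply: eq_integral => x _.
  by rewrite !normal_pdfE// /normal_peak /normal_fun av.
pose s := Num.sqrt s2.
have ss : s ^+ 2 = s2 by rewrite sqr_sqrtr.
have s0 : s != 0 by rewrite -sqrf_eq0 ss.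
pose H : set (rvec R I) := [set x | B (\sum_(i <- k :: r) a i * x i)].
have mH : measurable H.
  by rewrite -[H]setTI; exact: measurable_lin.
(* Coordinate [k] is frozen and the others are redrawn: the inner probability is the induction
   hypothesis for [B] translated by [a k * Z k w]. *)
rewrite -[LHS]/(P (joint Z @^-1` H)) (iid_mix [set k]%SET iidZ mH).
rewrite -(normal_prob_conv s0 _ mB (a := a k)); last by rewrite ss.
rewrite -(iid_coord_integral k); last 2 first.
- pose S : set (R * R) := [set z | B (a k * z.1 + z.2)].
  have mS : measurable S.
    rewrite -[S]setTI; apply: (_ : measurable_fun setT (fun z : R * R => a k * z.1 + z.2)) => //.
    by apply: measurable_funD => //; exact: measurable_funM.
  rewrite (_ : (fun y => _) = (normal_prob 0 s \o xsection S)).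
    exact: measurable_fun_xsection.
  by apply/funext => y /=; congr (normal_prob _ _ _); apply/seteqP; split=> x /=;
    rewrite /xsection /= in_setE.
- by move=> y; exact: measure_ge0.
apply: eq_integral => w _.
rewrite -(IH s)//; last first.
  by rewrite -[X in measurable X]setTI; exact: measurable_funD.
congr (P _); apply/funext => w'; rewrite /H/= big_cons /mix finset.in_set1 eqxx.
congr (B (_ + _)); apply: eq_big_seq => i ir; rewrite finset.in_set1.
by case: eqP ir kr => // -> ->.
Qed.

End iid_linear.

(** * Gaussian null sets *)

Section null_sets.
Context {R : realType} d (T : measurableType d) (P : probability T R).
Context {I : finType} (Z : I -> T -> R).
Hypothesis iidZ : iid_std_normal P Z.

Definition iid_null (A : set (rvec R I)) :=
  measurable A /\ P (joint Z @^-1` A) = 0%E.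

(** The normal density is positive everywhere, so normal null sets are Lebesgue null, hence null for
    every normal law, in particular for the image under the affine map. *)
Lemma normal_prob01_null (c h : R) (B : set R) : 0 < c -> measurable B ->
  normal_prob 0 1 B = 0%E -> normal_prob 0 1 [set t | B (c * t + h)] = 0%E.
Proof.
move=> c0 mB B0; have n1 : (1 : R) != 0 := oner_neq0 R.
rewrite (normal_prob_affine h c0 n1 mB).
suff lebB : leb B = 0%E.
  by have /null_content_dominatesP := @normal_prob_dominates R h (c * 1); apply.
have mpdf : measurable_fun B (fun x : measurableTypeR R => (normal_pdf 0 1 x)%:E).
  by apply: measurable_funTS; apply/measurable_EFinP; exact: measurable_normal_pdf.
have : (\int[leb]_(x in B) `|(normal_pdf 0 1 x)%:E| = 0)%E.
  rewrite -[RHS]B0; apply: eq_integral => x _.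
  by rewrite gee0_abs// lee_fin normal_pdf_ge0.
move=> /(ae_eq_integral_abs leb mB mpdf) ae0.
apply/(negligibleP leb mB); apply: negligibleS ae0 => x Bx /= /(_ Bx) /eqP.
rewrite eqe normal_pdfE// mulf_eq0 /normal_fun !gt_eqF ?expR_gt0//.
exact: normal_peak_gt0.
Qed.

Definition upd (k : I) (y : R) (x : rvec R I) : rvec R I :=
  fun i => if i == k then y else x i.

Lemma measurable_upd (k : I) (A : set (rvec R I)) :
  measurable A -> measurable [set z : T * R | A (upd k z.2 (joint Z z.1))].
Proof.
move=> mA.
have mf : measurable_fun setT (fun z : T * R => upd k z.2 (joint Z z.1)).
  apply: measurable_rvec => i; rewrite /upd; case: eqP => _; first exact: measurable_snd.
  by apply: measurableT_comp => //; exact: iidZ.1.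
exact: (measurable_preimage mf mA).
Qed.

(** With the other coordinates fixed, [h] is a constant because it ignores coordinate [k], and the
    update is an affine map of a line with positive slope. Such maps pull null sets back to null
    sets; Tonelli over the other coordinates concludes. *)
Lemma null_update (k : I) (c : R) (h : rvec R I -> R) (A : set (rvec R I)) :
  0 < c -> measurable_fun setT h -> (forall y x, h (upd k y x) = h x) ->
  iid_null A -> iid_null ((fun x : rvec R I => upd k (c * x k + h x) x) @^-1` A).
Proof.
move=> c0 mh hk [mA A0].
have mU : measurable_fun setT (fun x : rvec R I => upd k (c * x k + h x) x).
  apply: measurable_rvec => i; rewrite /upd; case: eqP => _; last exact: measurable_coord.
  apply: measurable_funD => //; apply: measurable_funM => //; exact: measurable_coord.
have mUA : measurable ((fun x : rvec R I => upd k (c * x k + h x) x) @^-1` A).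
  exact: (measurable_preimage mU mA).
split => //.
have mixE x y : mix (~: [set k])%SET x y = upd k (y k) x.
  by apply/funext => i; rewrite /mix /upd !inE; case: eqP => // ->.
have mslice w (B : set (rvec R I)) : measurable B ->
    measurable [set t : R | B (upd k t (joint Z w))].
  move=> mB; have := measurable_xsection w (measurable_upd k mB).
  by congr measurable; apply/seteqP; split=> t; rewrite /xsection /= in_setE.
have inner (B : set (rvec R I)) w : measurable B ->
    P [set w' | B (mix (~: [set k])%SET (joint Z w) (joint Z w'))] =
    normal_prob 0 1 [set t | B (upd k t (joint Z w))].
  move=> mB; rewrite -(iid_coord iidZ k); last exact: mslice.
  by congr (P _); apply/funext => w' /=; rewrite mixE.
have minner (B : set (rvec R I)) : measurable B -> measurable_fun setT (fun w =>
    normal_prob 0 1 [set t | B (upd k t (joint Z w))]).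
  move=> mB; rewrite (_ : (fun _ => _) = normal_prob 0 1 \o
      xsection [set z : T * R | B (upd k z.2 (joint Z z.1))]).
    exact: (@measurable_fun_xsection _ _ T (measurableTypeR R) R (normal_prob 0 1) _ (measurable_upd k mB)).
  by apply/funext => w /=; congr (normal_prob _ _ _); apply/seteqP; split=> t;
    rewrite /xsection /= in_setE.
rewrite (iid_mix (~: [set k])%SET iidZ mUA).
under eq_integral => w _ do rewrite inner//.
rewrite (ae_eq_integral (cst 0%E))//; [by rewrite integral0|exact: minner|].
have : (\int[P]_w `|normal_prob 0 1 [set t | A (upd k t (joint Z w))]| = 0)%E.
  rewrite -[RHS]A0 (iid_mix (~: [set k])%SET iidZ mA).
  by apply: eq_integral => w _; rewrite inner// gee0_abs.
move=> /(ae_eq_integral_abs P measurableT (minner _ mA)).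
apply: filterS => w /(_ Logic.I) Aw0 _ /=.
rewrite -(@normal_prob01_null c (h (joint Z w)) _ c0 (mslice w _ mA) Aw0).
congr (normal_prob _ _ _); apply/funext => t /=.
have -> : upd k (c * upd k t (joint Z w) k + h (upd k t (joint Z w))) (upd k t (joint Z w)) =
          upd k (c * t + h (joint Z w)) (joint Z w).
  by apply/funext => i; rewrite hk /upd eqxx; case: eqP.
by [].
Qed.

(** Since each [h i] reads only coordinates outside [K], the simultaneous update is a composition of
    single updates that do not disturb one another. *)
Lemma null_batch (K : {set I}) (c : R) (h : I -> rvec R I -> R) (A : set (rvec R I)) :
  0 < c -> (forall i, measurable_fun setT (h i)) ->
  (forall i (x y : rvec R I), (forall j, j \notin K -> x j = y j) -> h i x = h i y) ->
  iid_null A ->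
  iid_null ((fun x : rvec R I => (fun i => if i \in K then c * x i + h i x else x i) : rvec R I)
    @^-1` A).
Proof.
move=> c0 mh hK.
pose U (r : seq I) (x : rvec R I) : rvec R I := fun i => if i \in r then c * x i + h i x else x i.
suff H (r : seq I) (A' : set (rvec R I)) : uniq r -> {subset r <= K} -> iid_null A' ->
    iid_null (U r @^-1` A').
  move=> nA; have := H (enum K) A (enum_uniq _) _ nA.
  have -> : (fun x : rvec R I => (fun i => if i \in K then c * x i + h i x else x i) : rvec R I)
      = U (enum K) by apply/funext => x; apply/funext => i; rewrite /U mem_enum.
  by apply => i; rewrite mem_enum.
elim: r A' => [|k r IH] A' /=; first by move=> _ _; congr iid_null.
move=> /andP[kr ur] sub nA'.
have kK : k \in K by apply: sub; rewrite mem_head.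
have nk : iid_null ((fun x : rvec R I => upd k (c * x k + h k x) x) @^-1` A').
  apply: null_update => // y x; apply: hK => j jK.
  by rewrite /upd; case: eqP jK => // ->; rewrite kK.
have sub' : {subset r <= K} by move=> i ir; apply: sub; rewrite inE ir orbT.
have := IH _ ur sub' nk; congr iid_null.
apply/funext => x /=; congr A'; apply/funext => i; rewrite /upd /U inE.
have [->|//] := eqVneq i k; rewrite (negbTE kr); congr (_ + _).
by apply: hK => j jK; case: ifP => // /sub'; rewrite (negbTE jK).
Qed.

(** By Tonelli, if every orbit [t |-> L t x], [1 <= t < rho], meets [A] at most once,
    then [L t @^-1` A] is null for almost every [t]; one such [t] suffices. *)
Lemma null_flow (L L' : R -> rvec R I -> rvec R I) (rho : R) (A : set (rvec R I)) :
  1 < rho -> measurable A ->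
  measurable_fun setT (fun z : R * rvec R I => L z.1 z.2) ->
  (forall t x, 1 <= t -> L t (L' t x) = x) ->
  (forall t (B : set (rvec R I)), 1 <= t -> iid_null B -> iid_null (L' t @^-1` B)) ->
  (forall x t t', 1 <= t -> t < t' -> t' < rho -> A (L t x) -> A (L t' x) -> False) ->
  iid_null A.
Proof.
move=> rho1 mA mL LK nullL' small.
pose D : set R := `[1, rho[%classic.
pose S : set (R * T) := [set z | D z.1 /\ A (L z.1 (joint Z z.2))].
have mS : measurable S.
  rewrite (_ : S = (D `*` setT) `&` (fun z : R * T => L z.1 (joint Z z.2)) @^-1` A).
    apply: measurableI.
      by apply: measurableX => //; exact: measurable_itv.
    have mLZ : measurable_fun setT (fun z : R * T => L z.1 (joint Z z.2)).
      have mpair : measurable_fun setT (fun z : R * T => (z.1, joint Z z.2 : rvec R I)).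
        apply: measurable_fun_pair => //.
        apply: (measurableT_comp (measurable_joint iidZ)); exact: measurable_snd.
      exact: (measurableT_comp mL mpair).
    exact: (measurable_preimage mLZ mA).
  by apply/seteqP; split=> -[t w] /=; [case|case; case].
have E := @indic_fubini_tonelli _ _ (measurableTypeR R) T R leb P S mS.
have E0 : (\int[leb]_t (P \o xsection S) t = 0)%E.
  rewrite -indic_fubini_tonelli_FE// E indic_fubini_tonelli_GE//.
  apply: integral0_eq => w _ /=; apply: countable_lebesgue_measure0.
  have [[t tS]|n] := pselect (exists t, ysection S w t); last first.
    rewrite (_ : ysection S w = set0)//; apply/seteqP; split=> // t tS; apply: n; exists t; exact: tS.
  apply: (@sub_countable _ _ _ [set t]); last exact: countable1.
  apply: subset_card_le => t' t'S; move: tS t'S.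
  rewrite /ysection /= !in_setE /S /D /= !in_itv /= => -[/andP[t1 tr] At] [/andP[t1' tr'] At'].
  by have [tt|tt|//] := ltgtP t t'; [case: (small _ _ _ t1 tt tr' At At')|case: (small _ _ _ t1' tt tr At' At)].
have mPS : measurable_fun setT (P \o xsection S) by exact: measurable_fun_xsection.
have [t [t1 tr] Pt] : exists2 t, 1 <= t /\ t < rho & P (xsection S t) = 0%E.
  apply: contrapT => nex.
  have : (\int[leb]_t `|(P \o xsection S) t| = 0)%E.
    by rewrite -[RHS]E0; apply: eq_integral => t _; rewrite gee0_abs.
  move=> /(ae_eq_integral_abs leb measurableT mPS) ae0.
  have : leb D = 0%E.
    apply/(negligibleP leb (measurable_itv _)); apply: negligibleS ae0 => t /=.
    rewrite in_itv/= => /andP[t1 tr] /(_ Logic.I) Pt; apply: nex; exists t => //.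
  rewrite lebesgue_measure_itv/= lte_fin rho1 -EFinD => /eqP.
  by rewrite eqe subr_eq0 gt_eqF.
have mLt : measurable_fun setT (L t).
  have mpair : measurable_fun setT (fun x : rvec R I => (t, x)) by exact: measurable_fun_pair.
  exact: (measurableT_comp mL mpair).
have nLt : iid_null (L t @^-1` A).
  split; first exact: (measurable_preimage mLt mA).
  rewrite -[RHS]Pt; congr (P _); apply/seteqP; split=> w; rewrite /xsection /= in_setE /S /D /= in_itv/=.
    by rewrite t1 tr.
  by case.
have := nullL' _ _ t1 nLt; congr iid_null.
by apply/funext => x /=; rewrite LK.
Qed.

End null_sets.

(** * The sorted penalty *)

Section norm2.
Context {R : realType}.

Lemma norm2_ge0 n (u : 'cV[R]_n) : 0 <= norm2 u.
Proof. exact: sqrtr_ge0. Qed.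

Lemma norm2_sqr n (u : 'cV[R]_n) : norm2 u ^+ 2 = \sum_k u k 0 ^+ 2.
Proof. by rewrite sqr_sqrtr// sumr_ge0// => i _; exact: sqr_ge0. Qed.

Lemma norm2Z n (a : R) (u : 'cV[R]_n) : norm2 (a *: u) = `|a| * norm2 u.
Proof.
rewrite /norm2 -sqrtr_sqr -sqrtrM ?sqr_ge0// mulr_sumr; congr Num.sqrt.
by apply: eq_bigr => i _; rewrite mxE exprMn.
Qed.

Lemma cauchy_schwarz n (u v : 'cV[R]_n) :
  \sum_k u k 0 * v k 0 <= norm2 u * norm2 v.
Proof.
set a := norm2 u; set b := norm2 v; set S := \sum_k _.
have a0 : 0 <= a by exact: norm2_ge0.
have b0 : 0 <= b by exact: norm2_ge0.
have key (x y : R) : 0 <= x ^+ 2 * a ^+ 2 - 2 * x * y * S + y ^+ 2 * b ^+ 2.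
  rewrite !norm2_sqr !mulr_sumr -sumrB -big_split/=; apply: sumr_ge0 => i _.
  by rewrite (_ : _ + _ = (x * u i 0 - y * v i 0) ^+ 2) ?sqr_ge0//; ring.
(* The choice [x = b], [y = a] turns the square into [2ab(ab - S)], which gives the claim unless
   [ab = 0]; then one of the vectors is zero. *)
have := key b a.
have -> : b ^+ 2 * a ^+ 2 - 2 * b * a * S + a ^+ 2 * b ^+ 2 = 2 * (a * b) * (a * b - S) by ring.
have [ab0 _|ab0] := eqVneq (a * b) 0.
  have [a00|b00] : a = 0 \/ b = 0 by move/eqP: ab0; rewrite mulf_eq0 => /orP[/eqP|/eqP]; [left|right].
    have [u0|] := eqVneq u 0.
      by rewrite ab0 /S u0 big1// => i _; rewrite mxE mul0r.
    suff -> : u = 0 by rewrite eqxx.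
    apply/matrixP => i j; rewrite ord1 mxE; apply/eqP; rewrite -sqrf_eq0; apply/eqP.
    have /eqP := norm2_sqr u; rewrite -/a a00 expr0n/= eq_sym psumr_eq0.
      by move=> /allP/(_ i (mem_index_enum _))/eqP.
    by move=> k _; exact: sqr_ge0.
  have [v0|] := eqVneq v 0.
    by rewrite ab0 /S v0 big1// => i _; rewrite mxE mulr0.
  suff -> : v = 0 by rewrite eqxx.
  apply/matrixP => i j; rewrite ord1 mxE; apply/eqP; rewrite -sqrf_eq0; apply/eqP.
  have /eqP := norm2_sqr v; rewrite -/b b00 expr0n/= eq_sym psumr_eq0.
    by move=> /allP/(_ i (mem_index_enum _))/eqP.
  by move=> k _; exact: sqr_ge0.
by rewrite pmulr_rge0 ?subr_ge0// mulr_gt0// lt_neqAle eq_sym ab0 mulr_ge0.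
Qed.

Lemma norm2D n (u v : 'cV[R]_n) : norm2 (u + v) <= norm2 u + norm2 v.
Proof.
rewrite -(@ler_pXn2r _ 2)// ?nnegrE ?addr_ge0 ?norm2_ge0//.
rewrite sqrrD !norm2_sqr.
have -> : \sum_k (u + v) k 0 ^+ 2 = \sum_k u k 0 ^+ 2 + (\sum_k u k 0 * v k 0) *+ 2 + \sum_k v k 0 ^+ 2.
  rewrite -sumrMnl -!big_split/=; apply: eq_bigr => i _; rewrite mxE; ring.
by rewrite lerD2r lerD2l lerMn2r cauchy_schwarz.
Qed.

Lemma norm2_le_sum n (u : 'cV[R]_n) : norm2 u <= \sum_k `|u k 0|.
Proof.
rewrite -(@ler_pXn2r _ 2)// ?nnegrE ?norm2_ge0 ?sumr_ge0// norm2_sqr.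
rewrite expr2 mulr_suml; apply: ler_sum => i _.
rewrite -real_normK ?num_real// expr2 ler_wpM2l// (bigD1 i)//= lerDl.
by apply: sumr_ge0.
Qed.

End norm2.

Section weighted_sum.
Context {R : realType}.
Implicit Types (lam : nat -> R) (s : seq R).

Fixpoint wsum lam s : R :=
  if s is x :: s' then lam 0%N * x + wsum (fun k => lam k.+1) s' else 0.

Lemma wsumE lam s : wsum lam s = \sum_(k < size s) lam k * nth 0 s k.
Proof.
elim: s lam => [|x s IH] lam /=; first by rewrite big_ord0.
by rewrite big_ord_recl/= IH.
Qed.

Fixpoint ins (x : R) s : seq R :=
  if s is y :: s' then if y <= x then x :: s else y :: ins x s' else [:: x].

Lemma perm_ins x s : perm_eq (ins x s) (x :: s).
Proof.
elim: s => [|y s IH] //=; case: ifP => // _.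
by rewrite -(perm_cons y) in IH; rewrite (perm_trans IH)// (perm_catCA [:: y] [:: x] s).
Qed.

Lemma path_ins (y x : R) s : x <= y -> path >=%R y s -> path >=%R y (ins x s).
Proof.
elim: s y => [|z s IH] y xy /=; first by rewrite xy.
move=> /andP[zy ps]; case: ifP => [zx|/negbT zx] /=; first by rewrite xy zx.
by rewrite zy IH// ltW// ltNge.
Qed.

Lemma sorted_ins (x : R) s : sorted >=%R s -> sorted >=%R (ins x s).
Proof.
case: s => [|y s] //= ps; case: ifP => [yx|/negbT yx] /=; first by rewrite yx.
by apply: path_ins => //; rewrite ltW// ltNge.
Qed.

(** Each time [x] moves past a larger [y], the sum grows by [(lam 0 - lam 1)(y - x)], which is
    non-negative for decreasing weights. *)
Lemma wsum_ins lam x s : (forall k, lam k.+1 <= lam k) ->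
  wsum lam (x :: s) <= wsum lam (ins x s).
Proof.
elim: s lam => [|y s IH] lam lamd //=.
case: ifP => [//|/negbT]; rewrite -ltNge => xy /=.
have := IH (fun k => lam k.+1) (fun k => lamd k.+1).
move=> /= /(lerD (lexx (lam 0%N * y))); apply: le_trans.
have : 0 <= (lam 0%N - lam 1%N) * (y - x) 
  by apply: mulr_ge0; rewrite subr_ge0; [exact: (lamd 0%N)|exact: ltW].
by move=> h; lra.
Qed.

(** Rearrangement inequality, obtained along insertion sort, where every step is covered by
    [wsum_ins]; the sorted permutation of a list is unique, so the result agrees with [sort]. *)
Lemma wsum_le_sort lam s : (forall k, lam k.+1 <= lam k) ->
  wsum lam s <= wsum lam (sort >=%R s).
Proof.
move=> lamd; have trn : transitive (>=%R : rel R) by move=> y x z /= xy yz; exact: le_trans yz xy.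
have antis : antisymmetric (>=%R : rel R) by move=> x y /= /andP[yx xy]; apply/le_anti; rewrite xy.
have tot : total (>=%R : rel R) by move=> x y; exact: le_total.
pose isort := foldr ins [::].
have isort_perm t : perm_eq (isort t) t.
  elim: t => //= x t IH; rewrite (perm_trans (perm_ins _ _))//.
  by rewrite perm_cons.
have isort_sorted t : sorted >=%R (isort t) by elim: t => //= x t; exact: sorted_ins.
suff : wsum lam s <= wsum lam (isort s).
  move/le_trans; apply; rewrite (_ : isort s = sort >=%R s)//.
  apply: (sorted_eq trn antis) => //; first exact: sort_sorted.
  by rewrite (perm_trans (isort_perm s))// perm_sym perm_sort.
elim: s lam lamd => [|x s IH] lam lamd //=.
apply: (le_trans _ (wsum_ins x (isort s) lamd)) => /=.
by rewrite lerD2l; apply: IH => k.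
Qed.

End weighted_sum.

Section penalty.
Context {R : realType} {p : nat}.
Variable lam : nat -> R.
Hypothesis lam_decr : forall k, lam k.+1 <= lam k.
Hypothesis lam_ge0 : forall k, 0 <= lam k.
Implicit Types (b : 'cV[R]_p) (s : 'S_p) (al : 'I_p -> R).

Definition pen b : R := \sum_(k < p) lam k * nth 0 (sorted_abs b) k.

Lemma size_sorted_abs b : size (sorted_abs b) = p.
Proof. by rewrite size_sort size_map size_enum_ord. Qed.

Lemma penE b : pen b = wsum lam (sort >=%R [seq `|b i 0| | i <- enum 'I_p]).
Proof. by rewrite wsumE -[sort _ _]/(sorted_abs b) size_sorted_abs. Qed.

Definition arranged b s := [seq `|b (s k) 0| | k <- enum 'I_p].

Lemma perm_arranged b s : perm_eq (arranged b s) [seq `|b i 0| | i <- enum 'I_p].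
Proof.
rewrite /arranged (map_comp (fun i => `|b i 0|) s); apply: perm_map.
apply: uniq_perm; [by rewrite (map_inj_uniq (@perm_inj _ s)) enum_uniq|exact: enum_uniq|].
move=> i; rewrite mem_enum; apply/mapP; exists (s^-1 i)%g; first by rewrite mem_enum.
by rewrite permKV.
Qed.

Lemma wsum_arranged b s : wsum lam (arranged b s) = \sum_(k < p) lam k * `|b (s k) 0|.
Proof.
rewrite wsumE size_map size_enum_ord; apply: eq_bigr => k _; congr (_ * _).
by rewrite (nth_map k) ?size_enum_ord// nth_ord_enum.
Qed.

(** Together with [pen_arranged], this makes [pen] a maximum over permutations of weighted l1 norms;
    subadditivity [penD] follows by fixing the permutation that is optimal for the sum. *)
Lemma pen_ge_arranged b s : \sum_(k < p) lam k * `|b (s k) 0| <= pen b.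
Proof.
rewrite -wsum_arranged penE; apply: (le_trans (wsum_le_sort _ lam_decr)).
rewrite (_ : sort _ _ = sort >=%R [seq `|b i 0| | i <- enum 'I_p])//.
apply/perm_sortP; last exact: perm_arranged.
- by move=> x y; exact: le_total.
- by move=> y x z /= xy yz; exact: le_trans yz xy.
- by move=> x y /= /andP[yx xy]; apply/le_anti; rewrite xy.
Qed.

Lemma pen_arranged b s :
  (forall k l : 'I_p, (k <= l)%N -> `|b (s l) 0| <= `|b (s k) 0|) ->
  pen b = \sum_(k < p) lam k * `|b (s k) 0|.
Proof.
move=> bs; rewrite -wsum_arranged penE; congr wsum.
have trn : transitive (>=%R : rel R) by move=> y x z /= xy yz; exact: le_trans yz xy.
apply: (sorted_eq trn).
- by move=> x y /= /andP[yx xy]; apply/le_anti; rewrite xy.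
- by apply: sort_sorted => x y; exact: le_total.
- rewrite /arranged sorted_map.
  have : sorted leq (map val (enum 'I_p)) by rewrite val_enum_ord iota_sorted.
  by rewrite sorted_map; apply: sub_sorted => k l /= kl; exact: bs.
- by rewrite perm_sort perm_sym perm_arranged.
Qed.

Lemma exists_arranged b : exists s : 'S_p,
  forall k l : 'I_p, (k <= l)%N -> `|b (s l) 0| <= `|b (s k) 0|.
Proof.
pose e (i j : 'I_p) := `|b j 0| <= `|b i 0|.
pose r := sort e (enum 'I_p).
have tr : transitive e by move=> y x z xy yz; exact: le_trans yz xy.
have pr : perm_eq r (ord_tuple p) by rewrite perm_sort.
have /tuple_permP[s rs] := pr; exists s => k l kl.
have nr (i : 'I_p) : nth k r i = s i.
  by rewrite rs -tnth_nth tnth_mktuple tnth_ord_tuple.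
rewrite -!nr.
have sr : sorted e r by apply: sort_sorted => x y; exact: le_total.
have szr : size r = p by rewrite size_sort size_enum_ord.
have rfl : reflexive e by move=> i; exact: lexx.
by apply: (sorted_leq_nth tr rfl _ sr) => //; rewrite inE szr.
Qed.

Lemma penD b b' : pen (b + b') <= pen b + pen b'.
Proof.
have [s bs] := exists_arranged (b + b').
rewrite (pen_arranged bs).
apply: (le_trans _ (lerD (pen_ge_arranged b s) (pen_ge_arranged b' s))).
rewrite -big_split/=; apply: ler_sum => k _.
by rewrite -mulrDr ler_wpM2l// mxE ler_normD.
Qed.

Lemma penZ (a : R) b : pen (a *: b) = `|a| * pen b.
Proof.
have [s bs] := exists_arranged b.
rewrite (pen_arranged bs) (pen_arranged (b := a *: b) (s := s)).
  by rewrite mulr_sumr; apply: eq_bigr => k _; rewrite mxE normrM mulrCA.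
by move=> k l kl; rewrite !mxE !normrM ler_wpM2l// bs.
Qed.

Lemma pen_le b : pen b <= lam 0%N * \sum_i `|b i 0|.
Proof.
have [s bs] := exists_arranged b; rewrite (pen_arranged bs) mulr_sumr.
rewrite [leRHS](reindex_inj (perm_inj (s := s)))/=; apply: ler_sum => k _.
rewrite ler_wpM2r//; elim: (nat_of_ord k) => // m IH.
exact: le_trans (lam_decr m) IH.
Qed.

(** Coercivity of the penalty when the last weight is positive; it bounds near-minimizers in the
    compactness argument. *)
Lemma pen_ge_coord b i : lam p.-1 * `|b i 0| <= pen b.
Proof.
apply: (le_trans _ (pen_ge_arranged b 1%g)).
rewrite (bigD1 i)//= perm1 -[leLHS]addr0 lerD//; last first.
  by apply: sumr_ge0 => k _; rewrite mulr_ge0.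
rewrite ler_wpM2r//.
have : (i <= p.-1)%N by case: (p) i => [[]//|n] i /=; rewrite -ltnS.
move=> /subnK <-; elim: (p.-1 - i)%N => // m IH.
exact: le_trans (lam_decr _) IH.
Qed.

(** The cone of vectors whose absolute values are sorted by the permutation and whose
    signs are prescribed ([true] for negative). It is parametrized by the successive
    gaps [al] of the sorted absolute values, in which [pen] is linear. *)
Definition cone := ('S_p * {ffun 'I_p -> bool})%type.

Definition tail al (k : 'I_p) : R := \sum_(j < p | (k <= j)%N) al j.

Definition sgn (g : cone) (k : 'I_p) : R := (-1) ^+ g.2 k.

Definition cone_pt (g : cone) al : 'cV[R]_p :=
  \col_i (sgn g ((g.1)^-1 i)%g * tail al ((g.1)^-1 i)%g).

(** The gap [al k] raises the absolute values at positions [0] to [k], so its weight in the penalty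
    is this partial sum. *)
Definition cumul (k : 'I_p) : R := \sum_(j < p | (j <= k)%N) lam j.

Lemma normr_sgn g k : `|sgn g k| = 1.
Proof. by rewrite /sgn normrX normrN normr1 expr1n. Qed.

Lemma sgn_sqr g k : sgn g k * sgn g k = 1.
Proof. by rewrite /sgn -expr2 sqrr_sign. Qed.

Lemma tail_ge0 al k : (forall j, 0 <= al j) -> 0 <= tail al k.
Proof. by move=> al0; apply: sumr_ge0. Qed.

Lemma pen_cone g al : (forall j, 0 <= al j) ->
  pen (cone_pt g al) = \sum_k cumul k * al k.
Proof.
move=> al0.
have E k : `|cone_pt g al (g.1 k) 0| = tail al k.
  by rewrite mxE permK normrM normr_sgn mul1r ger0_norm// tail_ge0.
rewrite (pen_arranged (s := g.1)); last first.
  move=> k l kl; rewrite !E /tail.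
  rewrite [leRHS](bigID (fun j : 'I_p => (l <= j)%N))/=.
  rewrite (eq_bigl (fun j : 'I_p => (k <= j)%N && (l <= j)%N)); last first.
    by move=> j; case: (leqP l j) => lj; rewrite ?andbF// (leq_trans kl).
  by rewrite lerDl sumr_ge0.
under eq_bigr do rewrite E /tail mulr_sumr big_mkcond.
rewrite exchange_big/=; apply: eq_bigr => k _.
by rewrite -big_mkcond/= /cumul mulr_suml.
Qed.

Lemma cone_cover b : exists g al, (forall j, 0 <= al j) /\ b = cone_pt g al.
Proof.
have [s bs] := exists_arranged b.
(* Extending the sorted absolute values by 0 at index [p] makes the last gap equal to the smallest
   absolute value, and the telescoping sum of the gaps then ends at 0. *)
pose y (m : nat) : R := if insub m is Some k then `|b (s k) 0| else 0.
have yE (k : 'I_p) : y k = `|b (s k) 0| by rewrite /y insubT //= => ?; congr (`|b (s _) 0|); exact: val_inj.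
pose al (k : 'I_p) := y k - y k.+1.
exists (s, [ffun k => b (s k) 0 < 0]), al; split=> [j|].
  rewrite /al subr_ge0 yE {1}/y; case: insubP => [k _ kE|//].
  by apply: bs; rewrite kE.
apply/matrixP => i j; rewrite ord1 mxE /sgn /= ffunE permKV.
suff -> : tail al (s^-1 i)%g = `|b i 0|.
  by case: ltP => [bi|bi]; [rewrite ltr0_norm// expr1 mulN1r opprK|rewrite ger0_norm// expr0 mul1r].
rewrite -{2}(permKV s i) -yE; move: (s^-1 i)%g => {i j} k.
have yp : y p = 0 by rewrite /y insubF// ltnn.
rewrite /tail /al.
have -> : \sum_(j < p | (k <= j)%N) (y j - y j.+1) = \sum_(k <= j < p) (y j - y j.+1).
  by rewrite [RHS](big_nat_widenl _ 0)// big_mkord.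
under eq_bigr do rewrite -opprB; rewrite sumrN telescope_sumr ?(ltnW (ltn_ord k))//.
by rewrite yp sub0r opprK.
Qed.

End penalty.

(** * Almost sure uniqueness of the minimizer *)

Lemma measurable_sum_cond {R : realType} d (T : measurableType d) (J : finType)
    (P : pred J) (h : J -> T -> R) :
  (forall j, measurable_fun setT (h j)) ->
  measurable_fun setT (fun x => \sum_(j | P j) h j x).
Proof.
move=> mh; rewrite (_ : (fun x => _) =
    (fun x => \sum_(j <- [seq j <- index_enum J | P j]) h j x)).
  exact: measurable_sum.
by apply/funext => x; rewrite big_filter.
Qed.

(** * Scaling one generator column of the design *)

Section cone_flow.
Context {R : realType} {n p : nat}.
Let I : finType := ('I_n * 'I_p + 'I_n)%type.
Implicit Types (x : rvec R I) (g : cone (p := p)) (k m : 'I_p) (r : 'I_n).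

(** Row [r] of the image under the design of the [m]-th extremal ray of the cone, that is, of the
    cone point whose only nonzero gap is a unit gap at [m]. *)
Definition colsum g m r x : R :=
  \sum_(j < p | (j <= m)%N) sgn g j * x (inl (r, g.1 j)).

(** The change at position [k] affects every generator [m >= k]; the opposite change at position
    [k.+1] cancels it for [m > k]. For the last position there is no next one and nothing to
    cancel. *)
Definition flow_coef g k (i : 'I_p) : R :=
  let j := ((g.1)^-1)%g i in
  if j == k then sgn g k else if val j == k.+1 then - sgn g j else 0.

(** Multiplies the [k]-th generator column [colsum g k] of the design by [t], leaving the
    other generator columns unchanged. *)
Definition flow g k (t : R) x : rvec R I := fun e =>
  match e with
  | inl (r, i) => x (inl (r, i)) + (t - 1) * (flow_coef g k i * colsum g k r x)
  | inr r => x (inr r)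
  end.

Lemma sum_flow_coef g k m :
  \sum_(j < p | (j <= m)%N) sgn g j * flow_coef g k (g.1 j) = (m == k)%:R.
Proof.
have E (j : 'I_p) : sgn g j * flow_coef g k (g.1 j) =
    if j == k then 1 else if val j == k.+1 then -1 else 0.
  rewrite /flow_coef permK; case: eqP => [->|_]; first exact: sgn_sqr.
  by case: eqP => _; rewrite ?mulr0// mulrN sgn_sqr.
under eq_bigr do rewrite E.
have [mk|km|/val_inj mk] := ltngtP m k.
- rewrite big1 => [|j jm]; first by rewrite -val_eqE/= ltn_eqF.
  rewrite -val_eqE/= ltn_eqF ?(leq_ltn_trans jm)//.
  by rewrite ltn_eqF// (leq_ltn_trans jm)// ltnW.
- have k1p : (k.+1 < p)%N by exact: leq_ltn_trans km (ltn_ord m).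
  rewrite (bigD1 k) ?(ltnW km)//= eqxx (bigD1 (Ordinal k1p))/=; last first.
    by rewrite km -val_eqE/= gtn_eqF.
  rewrite eqxx -val_eqE/= gtn_eqF// big1 ?addr0; first by rewrite subrr -val_eqE/= gtn_eqF.
  by move=> j /andP[/andP[_ /negbTE->]]; rewrite -val_eqE/= => /negbTE ->.
- rewrite mk eqxx (bigD1 k)//= eqxx big1 ?addr0// => j /andP[jk /negbTE ->].
  by rewrite ltn_eqF// ltnS.
Qed.

Lemma colsum_flow g k m r t x :
  colsum g m r (flow g k t x) = (if m == k then t else 1) * colsum g m r x.
Proof.
rewrite /colsum.
transitivity (colsum g m r x + (t - 1) *
    ((\sum_(j < p | (j <= m)%N) sgn g j * flow_coef g k (g.1 j)) * colsum g k r x)).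
  rewrite mulr_suml mulr_sumr -big_split/=; apply: eq_bigr => j _.
  by rewrite mulrDr; congr (_ + _); ring.
rewrite sum_flow_coef; case: eqP => [->|_]; last by rewrite mul0r mulr0 addr0 mul1r.
by rewrite mul1r /colsum; ring.
Qed.

Lemma flow_comp g k t t' x : flow g k t (flow g k t' x) = flow g k (t * t') x.
Proof.
apply/funext => -[[r i]|r] //=; rewrite colsum_flow eqxx; ring.
Qed.

Lemma flow1 g k x : flow g k 1 x = x.
Proof. by apply/funext => -[[r i]|r] //=; rewrite subrr mul0r addr0. Qed.

Lemma measurable_colsum g m r : measurable_fun setT (colsum g m r).
Proof.
apply: measurable_sum_cond => j.
by apply: measurable_funM => //; exact: (measurable_coord (inl (r, g.1 j) : I)).
Qed.

Lemma measurable_flow g k : measurable_fun setT (fun z : R * rvec R I => flow g k z.1 z.2).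
Proof.
apply: measurable_rvec => -[[r i]|r] /=.
  apply: measurable_funD.
    exact: (measurableT_comp (measurable_coord (inl (r, i) : I)) measurable_snd).
  apply: measurable_funM; first exact: measurable_funB.
  apply: measurable_funM => //.
  exact: (measurableT_comp (measurable_colsum g k r) measurable_snd).
exact: (measurableT_comp (measurable_coord (inr r : I)) measurable_snd).
Qed.

Lemma null_flow_preimage d (T : measurableType d) (P : probability T R) (Z : I -> T -> R)
    g k (t : R) (B : set (rvec R I)) : iid_std_normal P Z -> 0 < t ->
  iid_null P Z B -> iid_null P Z (flow g k t @^-1` B).
Proof.
move=> iZ t0 nB.
(* The flow is a composition of two coordinatewise affine updates: column [g.1 k] is
   changed first, then the next column compensates. *)
pose K1 : {set I} := [set e | if e is inl (r, i) then i == g.1 k else false]%SET.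
pose K2 : {set I} := [set e | if e is inl (r, i) then val ((g.1)^-1 i)%g == k.+1 else false]%SET.
(* The [k]-th term of [colsum] is split off and contributes the slope [t], so [h1] reads only
   positions before [k]. In [h2] the sum is divided by [t] because it is evaluated after the first
   update, which has already multiplied it by [t]. *)
pose h1 (e : I) x : R := if e is inl (r, i) then
  (t - 1) * (sgn g k * \sum_(j < p | (j < k)%N) sgn g j * x (inl (r, g.1 j))) else 0.
pose h2 (e : I) x : R := if e is inl (r, i) then
  - ((t - 1) * (sgn g ((g.1)^-1 i)%g * (colsum g k r x / t))) else 0.
have mh1 e : measurable_fun setT (h1 e).
  case: e => [[r i]|r]; rewrite /h1 //; apply: measurable_funM => //; apply: measurable_funM => //.
  apply: measurable_sum_cond => j.
  by apply: measurable_funM => //; exact: (measurable_coord (inl (r, g.1 j) : I)).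
have mh2 e : measurable_fun setT (h2 e).
  case: e => [[r i]|r]; rewrite /h2 //; apply: measurableT_comp => //.
  apply: measurable_funM => //; apply: measurable_funM => //; apply: measurable_funM => //.
  exact: measurable_colsum.
have h1K e x y : (forall j, j \notin K1 -> x j = y j) -> h1 e x = h1 e y.
  case: e => [[r i]|r] //= xy; do 2 congr (_ * _); apply: eq_bigr => j jk.
  by rewrite xy// inE/= (inj_eq perm_inj) -val_eqE/= ltn_eqF.
have h2K e x y : (forall j, j \notin K2 -> x j = y j) -> h2 e x = h2 e y.
  case: e => [[r i]|r] //= xy; congr (- (_ * (_ * (_ / _)))); apply: eq_bigr => j jk.
  by rewrite xy// inE/= permK ltn_eqF.
have n2 := null_batch iZ ltr01 mh2 h2K nB.
have n1 := null_batch iZ t0 mh1 h1K n2.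
congr iid_null: n1; apply/funext => x /=; congr B.
have zE r : \sum_(j < p | (j < k)%N) sgn g j * x (inl (r, g.1 j)) =
    colsum g k r x - sgn g k * x (inl (r, g.1 k)).
  rewrite /colsum [in RHS](bigD1 k)//= addrAC subrr add0r; apply: eq_bigl => j.
  by rewrite ltn_neqAle andbC -val_eqE.
pose y : rvec R I := fun i => if i \in K1 then t * x i + h1 i x else x i.
have yk r : colsum g k r y = t * colsum g k r x.
  have : colsum g k r y - sgn g k * y (inl (r, g.1 k)) =
         colsum g k r x - sgn g k * x (inl (r, g.1 k)).
    rewrite /colsum (bigD1 k)//= [in RHS](bigD1 k)//= addrAC subrr add0r.
    rewrite [in RHS]addrAC subrr add0r; apply: eq_bigr => j /andP[_ jk].
    by rewrite /y inE/= (inj_eq perm_inj) (negbTE jk).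
  rewrite {2}/y inE/= eqxx /h1 zE => /eqP; rewrite subr_eq => /eqP ->.
  rewrite mulrDr.
  have -> : sgn g k * ((t - 1) * (sgn g k * (colsum g k r x - sgn g k * x (inl (r, g.1 k))))) =
    (sgn g k * sgn g k) * ((t - 1) * (colsum g k r x - sgn g k * x (inl (r, g.1 k)))) by ring.
  by rewrite sgn_sqr; ring.
apply/funext => -[[r i]|r] /=; last by rewrite !inE.
rewrite -/(y _) -/y !inE /flow_coef.
have [->|ik] := eqVneq i (g.1 k).
  rewrite permK eqxx ltn_eqF// /y inE/= eqxx /h1 zE.
  have -> : (t - 1) * (sgn g k * (colsum g k r x - sgn g k * x (inl (r, g.1 k)))) =
    (t - 1) * (sgn g k * colsum g k r x - (sgn g k * sgn g k) * x (inl (r, g.1 k))) by ring.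
  by rewrite sgn_sqr; ring.
have -> : ((g.1)^-1%g i == k) = false.
  by apply/negbTE; apply: contra ik => /eqP <-; rewrite permKV.
have yi : y (inl (r, i)) = x (inl (r, i)) by rewrite /y inE/= (negbTE ik).
rewrite yi; case: eqP => _; last by rewrite mul0r mulr0 addr0.
rewrite /h2 yk; field; exact: lt0r_neq0.
Qed.

End cone_flow.

Lemma measurable_fun_ltP {R : realType} d (T : measurableType d) (f : T -> R) :
  (forall r, measurable [set x | f x < r]) -> measurable_fun setT f.
Proof.
move=> mf; apply: (measurability _ (RGenInftyO.measurableE R)).
move=> _ [_ [r ->] <-]; rewrite setTI.
rewrite [X in measurable X](_ : _ = [set x | f x < r]); first exact: mf.
by apply/seteqP; split=> x /=; rewrite in_itv.
Qed.

(** * The value function on one cone *)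

Section cone_value.
Context {R : realType} {n p : nat}.
Let I : finType := ('I_n * 'I_p + 'I_n)%type.
Variables (c : R) (lam : nat -> R).
Hypothesis c_ge0 : 0 <= c.
Hypothesis lam_decr : forall k, lam k.+1 <= lam k.
Hypothesis lam_ge0 : forall k, 0 <= lam k.
Implicit Types (x : rvec R I) (g : cone (p := p)) (k m : 'I_p) (r : 'I_n)
  (al : 'I_p -> R) (t : R).

Definition design x : 'M[R]_(n, p) := \matrix_(i, j) x (inl (i, j)).
Definition response x : 'cV[R]_n := \col_i x (inr i).

Definition obj x (b : 'cV[R]_p) : R :=
  c * norm2 (response x - design x *m b) + 2 * pen lam b.

Definition resid g al x : 'cV[R]_n :=
  \col_r (x (inr r) - \sum_m al m * colsum g m r x).

(** Weighting the [k]-th gap by [t] amounts to dividing the [k]-th generator column by [t]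
    (lemma [cone_value_flow]), but makes the objective affine in [t]. *)
Definition cone_obj g k t al x : R :=
  c * norm2 (resid g al x) +
  2 * \sum_m (if m == k then t else 1) * (cumul lam m * al m).

Lemma resid_cone g al x : response x - design x *m cone_pt g al = resid g al x.
Proof.
apply/matrixP => r j; rewrite ord1 !mxE; congr (_ - _).
under eq_bigr do rewrite !mxE.
rewrite (reindex_inj (perm_inj (s := g.1)))/=.
under eq_bigr => j0 _ do rewrite permK /tail mulr_sumr mulr_sumr big_mkcond.
rewrite exchange_big/=; apply: eq_bigr => m _.
rewrite -big_mkcond/= /colsum mulr_sumr; apply: eq_bigr => j0 _.
by ring.
Qed.

Lemma cone_obj1 g k al x : (forall j, 0 <= al j) ->
  cone_obj g k 1 al x = obj x (cone_pt g al).
Proof.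
move=> al0; rewrite /cone_obj /obj resid_cone pen_cone//; congr (_ + 2 * _).
by apply: eq_bigr => m _; rewrite if_same mul1r.
Qed.

Lemma cumul_ge0 k : 0 <= cumul lam k.
Proof. exact: sumr_ge0. Qed.

Lemma cone_obj_ge0 g k t al x : 0 <= t -> (forall j, 0 <= al j) ->
  0 <= cone_obj g k t al x.
Proof.
move=> t0 al0; rewrite addr_ge0// mulr_ge0 ?norm2_ge0//.
by apply: sumr_ge0 => m _; rewrite mulr_ge0 ?mulr_ge0 ?cumul_ge0//; case: ifP.
Qed.

Lemma cone_objD g k t s al x :
  cone_obj g k (t + s) al x = cone_obj g k t al x + 2 * (s * (cumul lam k * al k)).
Proof.
rewrite /cone_obj -addrA -mulrDr; congr (_ + 2 * _).
rewrite (bigD1 k)//= [X in _ = X + _](bigD1 k)//= !eqxx.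
rewrite mulrDl -!addrA; congr (_ + _); rewrite addrC; congr (_ + _).
by apply: eq_bigr => m /negbTE ->.
Qed.

Definition lipschitz_const g t x : R :=
  \sum_m (c * \sum_r `|colsum g m r x| + 2 * (`|t| + 1) * cumul lam m).

Lemma cone_obj_lipschitz g k t (e : R) al al' x :
  (forall m, `|al m - al' m| <= e) ->
  cone_obj g k t al' x <= cone_obj g k t al x + e * lipschitz_const g t x.
Proof.
move=> ale; rewrite /cone_obj /lipschitz_const big_split/= mulrDr.
rewrite addrACA; apply: lerD.
  have -> : resid g al' x = resid g al x + \col_r \sum_m (al m - al' m) * colsum g m r x.
    apply/matrixP => r j; rewrite !mxE -addrA; congr (_ + _).
    rewrite -sumrN -sumrN -big_split/=; apply: eq_bigr => m _; ring.
  apply: (le_trans (ler_wpM2l c_ge0 (norm2D _ _))).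
  rewrite mulrDr lerD2l -mulr_sumr mulrCA ler_wpM2l//.
  apply: (le_trans (norm2_le_sum _)); rewrite exchange_big/= mulr_sumr.
  apply: ler_sum => r _; rewrite mxE.
  apply: (le_trans (ler_norm_sum _ _ _)); rewrite mulr_sumr; apply: ler_sum => m _.
  by rewrite normrM ler_wpM2r.
rewrite mulr_sumr mulr_sumr [in X in _ <= _ + X]mulr_sumr -big_split/=.
apply: ler_sum => m _.
set s := if _ then _ else _.
have s1 : `|s| <= `|t| + 1.
  by rewrite /s; case: ifP => _; rewrite ?normr1 ?lerDl ?lerDr.
have -> : 2 * (s * (cumul lam m * al' m)) =
  2 * (s * (cumul lam m * al m)) + 2 * cumul lam m * (- s * (al m - al' m)) by ring.
have -> : e * (2 * (`|t| + 1) * cumul lam m) = 2 * cumul lam m * ((`|t| + 1) * e) by ring.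
rewrite lerD2l ler_wpM2l ?mulr_ge0 ?cumul_ge0//.
apply: (le_trans (ler_norm _)); rewrite normrM normrN.
by apply: ler_pM.
Qed.

(** Approximating from above keeps non-negative gaps non-negative. *)
Lemma rat_approx al (e : R) : 0 < e ->
  exists q : {ffun 'I_p -> rat}, forall m, al m < ratr (q m) < al m + e.
Proof.
move=> e0.
have /choice[f fP] : forall m, exists q : rat, al m < ratr q < al m + e.
  move=> m; have /rat_in_itvoo[q] : al m < al m + e by rewrite ltrDl.
  by rewrite in_itv/=; exists q.
by exists [ffun m => f m] => m; rewrite ffunE.
Qed.

Definition nonneg_coef : set ('I_p -> R) := [set al | forall j, 0 <= al j].

Definition cone_value g k t x : R :=
  inf [set cone_obj g k t al x | al in nonneg_coef].

Let nonempty g k t x : [set cone_obj g k t al x | al in nonneg_coef] !=set0.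
Proof. by exists (cone_obj g k t (fun=> 0) x), (fun=> 0). Qed.

Lemma cone_value_le g k t al x : 0 <= t -> (forall j, 0 <= al j) ->
  cone_value g k t x <= cone_obj g k t al x.
Proof.
move=> t0 al0; apply: ge_inf; last by exists al.
by exists 0 => _ [al' al'0 <-]; exact: cone_obj_ge0.
Qed.

Lemma le_cone_value g k t x (r : R) :
  (forall al, (forall j, 0 <= al j) -> r <= cone_obj g k t al x) ->
  r <= cone_value g k t x.
Proof. by move=> h; apply: lb_le_inf => // _ [al al0 <-]; exact: h. Qed.

(** By the Lipschitz bound in the gaps, the infimum may be taken over rational ones. This writes the
    sublevel sets of the value as countable unions and yields measurability in [x]. *)
Lemma cone_value_lt g k t x (r : R) : 0 <= t ->
  cone_value g k t x < r <->
  exists q : {ffun 'I_p -> rat}, (forall j, 0 <= ratr (q j) :> R) /\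
    cone_obj g k t (fun j => ratr (q j)) x < r.
Proof.
move=> t0; split=> [/inf_lt[//|_ [al al0 <-]] alr|[q [q0]]]; last first.
  by apply: le_lt_trans; exact: cone_value_le.
have K0 : 0 <= lipschitz_const g t x.
  apply: sumr_ge0 => m _; rewrite addr_ge0 ?(mulr_ge0 c_ge0) ?sumr_ge0//.
  by rewrite mulr_ge0 ?cumul_ge0// mulr_ge0// addr_ge0.
(* The error is at most [e] times the Lipschitz constant, hence at most half of the room below [r];
   the added 1 keeps the denominator positive. *)
pose e := (r - cone_obj g k t al x) / (lipschitz_const g t x + 1) / 2.
have e0 : 0 < e by rewrite !divr_gt0 ?subr_gt0// ltr_wpDl.
have [q qP] := rat_approx al e0; exists q; split=> [j|].
  by have /andP[/ltW + _] := qP j; exact: le_trans.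
have ae m : `|al m - ratr (q m)| <= e.
  by have /andP[q1 q2] := qP m; rewrite ler_norml; lra.
apply: (le_lt_trans (@cone_obj_lipschitz g k t e al _ x ae)).
have eK : e * lipschitz_const g t x + e = (r - cone_obj g k t al x) / 2.
  by rewrite /e; field; rewrite gt_eqF// ltr_wpDl.
by move: alr; move: (_ * _) eK => eL; lra.
Qed.

Lemma measurable_norm2_col d (T : measurableType d) (f : 'I_n -> T -> R) :
  (forall r, measurable_fun setT (f r)) ->
  measurable_fun setT (fun w => norm2 (\col_r f r w)).
Proof.
move=> mf; rewrite /norm2.
apply: (measurableT_comp (continuous_measurable_fun (@sqrt_continuous R))).
apply: measurable_sum => r; apply: measurable_funX.
by under eq_fun do rewrite mxE; exact: mf.
Qed.

Lemma measurable_cone_obj g k t al : measurable_fun setT (cone_obj g k t al).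
Proof.
rewrite /cone_obj; apply: measurable_funD => //; apply: measurable_funM => //.
apply: measurable_norm2_col => r; apply: measurable_funB.
  exact: (measurable_coord (inr r : I)).
apply: measurable_sum => m; apply: measurable_funM => //.
exact: measurable_colsum.
Qed.

Lemma measurable_cone_value g k t : 0 <= t -> measurable_fun setT (cone_value g k t).
Proof.
move=> t0; apply: measurable_fun_ltP => r.
rewrite [X in measurable X](_ : _ = \bigcup_(q : {ffun 'I_p -> rat})
    [set x | (forall j, 0 <= ratr (q j) :> R) /\
       cone_obj g k t (fun j => ratr (q j)) x < r]); last first.
  apply/seteqP; split=> x /=; first by move/(cone_value_lt _ _ _ _ t0) => [q qP]; exists q.
  by move=> [q _ qP]; apply/(cone_value_lt _ _ _ _ t0); exists q.
apply: countable_bigcupT_measurable; first exact: countableP.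
move=> q; have [q0|nq0] := pselect (forall j, 0 <= ratr (q j) :> R).
  rewrite [X in measurable X](_ : _ = cone_obj g k t (fun j => ratr (q j)) @^-1` `]-oo, r[%classic).
    apply: measurable_preimage; first exact: measurable_cone_obj.
    exact: measurable_itv.
  by apply/seteqP; split=> x /=; rewrite in_itv/=; [case|].
rewrite [X in measurable X](_ : _ = set0)//.
by apply/seteqP; split=> x //= [].
Qed.

Definition scale_coef k t al : 'I_p -> R := fun m => if m == k then t * al m else al m.

Lemma cone_obj_flow g k t s al x : t != 0 ->
  cone_obj g k s al (flow g k t x) = cone_obj g k (s / t) (scale_coef k t al) x.
Proof.
move=> t0; rewrite /cone_obj /scale_coef; congr (c * norm2 _ + 2 * _).
  apply/matrixP => r j; rewrite !mxE/=; congr (_ - _); apply: eq_bigr => m _.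
  by rewrite colsum_flow; case: eqP => [->|_]; ring.
apply: eq_bigr => m _; case: eqP => [->|_//].
by field.
Qed.

(** Multiplying the [k]-th gap by [t > 0] is a bijection of the non-negative orthant, so it
    compensates the scaled column in the residual and moves the factor into the penalty weight. *)
Lemma cone_value_flow g k t s x : 0 < t -> 0 <= s ->
  cone_value g k s (flow g k t x) = cone_value g k (s / t) x.
Proof.
move=> t0 s0; have tn0 : t != 0 by rewrite gt_eqF.
have sc0 u al : 0 <= u -> (forall j, 0 <= al j) -> forall j, 0 <= scale_coef k u al j.
  by move=> u0 al0 j; rewrite /scale_coef; case: ifP => _ //; exact: mulr_ge0.
apply/eqP; rewrite eq_le; apply/andP; split; apply: le_cone_value => al al0.
  rewrite (_ : al = scale_coef k t (scale_coef k t^-1 al)).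
    rewrite -cone_obj_flow//; apply: cone_value_le => //; apply: sc0 => //.
    by rewrite invr_ge0 ltW.
  by apply/funext => m; rewrite /scale_coef; case: eqP => //; rewrite mulVKf.
rewrite cone_obj_flow//; apply: cone_value_le; first by rewrite divr_ge0// ltW.
by apply: sc0 => //; exact: ltW.
Qed.

(** Monotonicity in the time serves in [kink_orbit] to pass from a real time to a rational one
    slightly above it. *)
Lemma cone_value_homo g k s t x : 0 <= s -> s <= t ->
  cone_value g k s x <= cone_value g k t x.
Proof.
move=> s0 st; apply: le_cone_value => al al0.
apply: (le_trans (@cone_value_le g k s al x s0 al0)).
rewrite -(subrKC s t) cone_objD lerDl !mulr_ge0 ?cumul_ge0// subr_ge0//.
Qed.

End cone_value.

(** * Kinks of the value function and uniqueness of minimizers *)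

Section uniqueness.
Context {R : realType} {n p : nat}.
Let I : finType := ('I_n * 'I_p + 'I_n)%type.
Variables (c : R) (lam : nat -> R).
Hypothesis c_ge0 : 0 <= c.
Hypothesis lam_decr : forall k, lam k.+1 <= lam k.
Hypothesis lam_ge0 : forall k, 0 <= lam k.
Hypothesis lam_gt0 : 0 < lam p.-1.
Implicit Types (x : rvec R I) (g : cone (p := p)) (k m : 'I_p) (q : rat)
  (al : 'I_p -> R) (t : R) (b : 'cV[R]_p).

Let value g k t x := cone_value c lam g k t x.

(** Testing only rational times makes this a countable intersection of measurable sets. *)
Definition supergradient g k q : set (rvec R I) := [set x | forall t : rat, 0 < t ->
  value g k (ratr t) x <= value g k 1 x + ratr q * (ratr t - 1)].

(** Two distinct rational supergradients at 1 of the concave function [value g k ^~ x]. *)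
Definition kink g k q1 q2 : set (rvec R I) :=
  supergradient g k q1 `&` supergradient g k q2.

Lemma measurable_supergradient g k q : measurable (supergradient g k q).
Proof.
pose S (t : rat) : set (rvec R I) := [set x | 0 < t ->
  value g k (ratr t) x <= value g k 1 x + ratr q * (ratr t - 1)].
rewrite (_ : supergradient g k q = ~` \bigcup_t ~` S t); last first.
  apply/seteqP; split=> x /=; first by move=> H [t _ /=]; apply; exact: H.
  by move=> H t; apply: contrapT => nS; apply: H; exists t.
apply: measurableC; apply: bigcupT_measurable_rat => t; apply: measurableC.
have [t0|t0] := ltP 0 t; last first.
  rewrite [X in measurable X](_ : _ = setT)//; apply/seteqP; split=> x //= _.
  by rewrite /S/= ltNge t0.
pose B x := value g k (ratr t) x <= value g k 1 x + ratr q * (ratr t - 1).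
rewrite (_ : S t = B @^-1` [set true]); last first.
  by apply/seteqP; split=> x; [move=> /(_ t0)|move=> Bx _; exact: Bx].
apply: measurable_preimage => //; apply: measurable_fun_ler.
  by apply: measurable_cone_value => //; rewrite ler0q ltW.
by apply: measurable_funD => //; exact: measurable_cone_value.
Qed.

Lemma measurable_kink g k q1 q2 : measurable (kink g k q1 q2).
Proof. by apply: measurableI; exact: measurable_supergradient. Qed.

(** A supergradient [q] at [flow g k t x] has slope [t * ratr q] in the time scale of [x], and
    slopes decrease; so two kinks on one orbit are at least a factor [q2 / q1] apart. *)
Lemma kink_orbit g k q1 q2 x t t' : 0 < q1 -> 1 <= t -> t < t' ->
  t' < ratr q2 / ratr q1 -> kink g k q1 q2 (flow g k t x) ->
  kink g k q1 q2 (flow g k t' x) -> False.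
Proof.
move=> q10 t1 tt' t'q [_ H2] [H1 _].
have t0 : 0 < t by exact: lt_le_trans ltr01 t1.
have t'0 : 0 < t' by exact: lt_trans tt'.
have a0 : 0 < ratr q1 :> R by rewrite ltr0q.
set a := ratr q1 : R in a0 t'q H1 *; set d := ratr q2 : R in t'q H2 *.
have d0 : 0 < d.
  by move: (lt_trans t'0 t'q); rewrite pmulr_lgt0// invr_gt0.
pose u := t' / t.
have u1 : 1 < u by rewrite /u ltr_pdivlMr// mul1r.
have u0 : 0 < u by exact: lt_trans u1.
have ud : u * a < d.
  rewrite -ltr_pdivlMr//; apply: le_lt_trans t'q.
  by rewrite /u ler_pdivrMr// ler_peMr// ltW.
(* The inequality for [q1] at time [t'] is tested at [r1] near [u], the one for [q2] at time [t] at
   [r2] near [1/u]. Their sum gives [0 <= a (r1 - 1) + d (r2 - 1)]. At [r1 = u], [r2 = 1/u] the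
   right side is [-(u - 1)(d/u - a) < 0], and this [e] lets the rational errors consume less than
   half of it. *)
pose e := (u - 1) * (d / u - a) / (a + d) / 2.
have ad0 : 0 < a + d by rewrite addr_gt0.
have dua : 0 < d / u - a by rewrite subr_gt0 ltr_pdivlMr// mulrC.
have e0 : 0 < e by rewrite !divr_gt0// mulr_gt0// subr_gt0.
have /rat_in_itvoo[r1] : u < u + e by rewrite ltrDl.
rewrite in_itv/= => /andP[ur1 r1u].
have /rat_in_itvoo[r2] : u^-1 < u^-1 + e by rewrite ltrDl.
rewrite in_itv/= => /andP[ur2 r2u].
have r10 : 0 < r1 by rewrite -(ltr0q R) (lt_trans u0).
have r20 : 0 < r2 by rewrite -(ltr0q R) (lt_trans _ ur2)// invr_gt0.
have flowE q (w : R) : 0 < w -> 0 < q ->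
    value g k (ratr q) (flow g k w x) = value g k (ratr q / w) x.
  by move=> w0 q0; apply: cone_value_flow => //; rewrite ler0q ltW.
have flow1E (w : R) : 0 < w -> value g k 1 (flow g k w x) = value g k (1 / w) x.
  by move=> w0; exact: cone_value_flow.
have := H1 _ r10; rewrite flowE// flow1E// => E1.
have := H2 _ r20; rewrite flowE// flow1E// => E2.
have F1 : value g k (1 / t) x <= value g k (ratr r1 / t') x.
  apply: cone_value_homo => //; first by rewrite divr_ge0// ltW.
  rewrite ler_pdivlMr// mulrC mulrA mulr1; exact: ltW.
have F2 : value g k (1 / t') x <= value g k (ratr r2 / t) x.
  apply: cone_value_homo => //; first by rewrite divr_ge0// ltW.
  rewrite ler_pdivlMr// mulrC mulrA mulr1; apply: ltW.
  by move: ur2; rewrite /u invf_div.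
have : 0 <= a * (ratr r1 - 1) + d * (ratr r2 - 1).
  have := le_trans F2 E2; have := le_trans F1 E1; rewrite -/a -/d.
  by move: (value g k (1 / t) x) (value g k (1 / t') x) => v v'; lra.
apply/negP; rewrite -ltNge.
have : a * (ratr r1 - 1) + d * (ratr r2 - 1) < a * (u + e - 1) + d * (u^-1 + e - 1).
  by apply: ltrD; rewrite ltr_pM2l// ltrD2r.
move/lt_trans; apply.
have -> : a * (u + e - 1) + d * (u^-1 + e - 1) = - ((u - 1) * (d / u - a)) / 2.
  rewrite /e; field; rewrite !gt_eqF//.
by rewrite mulNr oppr_lt0 divr_gt0// mulr_gt0// subr_gt0.
Qed.

Lemma null_kink d (T : measurableType d) (P : probability T R) (Z : I -> T -> R)
  g k q1 q2 : iid_std_normal P Z -> 0 < q1 -> q1 < q2 ->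
  iid_null P Z (kink g k q1 q2).
Proof.
move=> iZ q10 q12.
apply: (@null_flow _ _ _ P _ Z iZ (flow g k) (fun t => flow g k t^-1) (ratr q2 / ratr q1)).
- by rewrite ltr_pdivlMr ?ltr0q// mul1r ltr_rat.
- exact: measurable_kink.
- exact: measurable_flow.
- by move=> t x t1; rewrite flow_comp mulfV ?flow1// gt_eqF// (lt_le_trans ltr01).
- move=> t B t1; apply: null_flow_preimage => //.
  by rewrite invr_gt0 (lt_le_trans ltr01).
- by move=> x t t' t1 tt' t'q K K'; exact: (kink_orbit q10 t1 tt' t'q K K').
Qed.

Definition minimizer x b := forall b', obj c lam x b <= obj c lam x b'.

Lemma cumul_gt0 k : 0 < cumul lam k.
Proof.
rewrite /cumul (bigD1 k)//= ltr_pwDl ?sumr_ge0//.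
apply: lt_le_trans lam_gt0 _.
have : (k <= p.-1)%N by case: (p) k => [[]//|m] k /=; rewrite -ltnS.
move=> /subnK <-; elim: (p.-1 - k)%N => // m IH.
exact: le_trans (lam_decr _) IH.
Qed.

(** For fixed gaps the objective is affine in [t], with slope twice [cumul lam k] times the [k]-th
    gap. The two minimizers give affine majorants of the value that touch it at [t = 1] with slopes
    [s < s']: the first controls [t >= 1], the second [t < 1], so every slope in between is a
    supergradient. *)
Lemma cone_minimizers_kink g k al al' x :
  (forall j, 0 <= al j) -> (forall j, 0 <= al' j) ->
  minimizer x (cone_pt g al) -> minimizer x (cone_pt g al') -> al k < al' k ->
  exists q1 q2, [/\ 0 < q1, q1 < q2 & kink g k q1 q2 x].
Proof.
move=> al0 al'0 mb mb' aa'.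
pose s := 2 * (cumul lam k * al k); pose s' := 2 * (cumul lam k * al' k).
have ss' : s < s' by rewrite /s /s' !ltr_pM2l// cumul_gt0.
have s0 : 0 <= s by rewrite !mulr_ge0// ltW// cumul_gt0.
have [q1] := rat_in_itvoo ss'; rewrite in_itv/= => /andP[sq1 q1s].
have [q2] := rat_in_itvoo q1s; rewrite in_itv/= => /andP[q12 q2s].
have v1 : value g k 1 x = obj c lam x (cone_pt g al).
  apply/eqP; rewrite eq_le; apply/andP; split.
    by rewrite -(cone_obj1 c lam g k x al0) cone_value_le.
  by apply: le_cone_value => al1 al10; rewrite cone_obj1.
have sg q : s < ratr q -> ratr q < s' -> supergradient g k q x.
  move=> sq qs' t t0; have t0R : 0 < ratr t :> R by rewrite ltr0q.
  have tE : ratr t = 1 + (ratr t - 1) :> R by rewrite addrC subrK.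
  have [t1|t1] := leP 1 (ratr t : R).
    apply: (le_trans (cone_value_le c_ge0 lam_ge0 g k x (ltW t0R) al0)).
    rewrite {1}tE cone_objD cone_obj1// v1 lerD2l mulrCA mulrC ler_wpM2r ?subr_ge0//.
    exact: ltW.
  apply: (le_trans (cone_value_le c_ge0 lam_ge0 g k x (ltW t0R) al'0)).
  rewrite {1}tE cone_objD cone_obj1// v1 (_ : obj _ _ _ _ = obj c lam x (cone_pt g al)); last first.
    by apply/eqP; rewrite eq_le mb mb'.
  rewrite lerD2l mulrCA mulrC ler_wnM2r ?subr_le0 ?ltW//.
exists q1, q2; split; [|by rewrite -(ltr_rat R)|split; apply: sg => //].
- by rewrite -(ltr0q R) (le_lt_trans s0).
- exact: lt_trans q12.
Qed.

Lemma obj_convex x b b' (u : R) : 0 <= u <= 1 ->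
  obj c lam x (b + u *: (b' - b)) <= (1 - u) * obj c lam x b + u * obj c lam x b'.
Proof.
move=> /andP[u0 u1]; have u1' : 0 <= 1 - u by rewrite subr_ge0.
have -> : b + u *: (b' - b) = (1 - u) *: b + u *: b'.
  by rewrite scalerBr scalerBl scale1r; rewrite -addrA [- _ + _]addrC addrA addrAC.
rewrite /obj mulmxDr -!scalemxAr.
have -> : response x - ((1 - u) *: (design x *m b) + u *: (design x *m b')) =
    (1 - u) *: (response x - design x *m b) + u *: (response x - design x *m b').
  rewrite !scalerBr addrACA -scalerDl subrK scale1r opprD//.
have h1 := norm2D ((1 - u) *: (response x - design x *m b)) (u *: (response x - design x *m b')).
have h2 := penD lam_decr lam_ge0 ((1 - u) *: b) (u *: b').
move: h1 h2; rewrite !norm2Z !penZ !ger0_norm// => h1 h2.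
apply: (le_trans (lerD (ler_wpM2l c_ge0 h1) (ler_wpM2l (ler0n _ 2) h2))).
by rewrite le_eqVlt; apply/orP; left; apply/eqP; ring.
Qed.

Lemma minimizers_kink x b b' : minimizer x b -> minimizer x b' -> b != b' ->
  exists g k q1 q2, [/\ 0 < q1, q1 < q2 & kink g k q1 q2 x].
Proof.
move=> mb mb' bb'.
(* The segment [b, b'] consists of minimizers; two of its points lie in the same cone. *)
pose N := #|{: cone (p := p)}|.
pose pt (j : 'I_N.+1) := b + (j%:R / N.+1%:R) *: (b' - b).
have mpt j : minimizer x (pt j).
  move=> b1; apply: (le_trans (obj_convex _ _ _ _)).
    rewrite divr_ge0//= ler_pdivrMr// mul1r ler_nat ltnW//.
  rewrite (_ : obj c lam x b' = obj c lam x b); last first.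
    by apply/eqP; rewrite eq_le mb mb'.
  by rewrite -mulrDl subrK mul1r.
have /choice[f fP] : forall j, exists ga : cone (p := p) * ('I_p -> R),
    (forall i, 0 <= ga.2 i) /\ pt j = cone_pt ga.1 ga.2.
  by move=> j; have [g [al [al0 E]]] := cone_cover (pt j); exists (g, al).
have : ~~ injectiveb (fun j => (f j).1).
  apply/negP => /injectiveP inj; have := leq_card _ inj.
  by rewrite card_ord ltnn.
move=> /injectivePn[j [j' jj' fE]].
have [[al0 E] [al'0 E']] := (fP j, fP j').
have ptn : pt j != pt j'.
  apply: contra jj' => /eqP /addrI /eqP; rewrite -subr_eq0 -scalerBl scaler_eq0.
  rewrite [b' - b == 0]subr_eq0 [b' == b]eq_sym (negbTE bb') orbF -mulrBl.
  by rewrite mulf_eq0 invr_eq0 pnatr_eq0 orbF subr_eq0 eqr_nat.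
have [k kn] : exists k, (f j).2 k != (f j').2 k.
  apply: contrapT => H; move/eqP: ptn; apply; rewrite E E' fE; congr cone_pt.
  by apply/funext => k; apply: contrapT => kn; apply: H; exists k; exact/eqP.
have mj := mpt j; rewrite E in mj.
have mj' := mpt j'; rewrite E' -fE in mj'.
exists (f j).1, k; case/lt_total/orP: kn => kn.
  exact: (cone_minimizers_kink al0 al'0 mj mj' kn).
exact: (cone_minimizers_kink al'0 al0 mj' mj kn).
Qed.

Definition kinks : set (rvec R I) := [set x |
  exists g k q1 q2, [/\ 0 < q1, q1 < q2 & kink g k q1 q2 x]].

Lemma null_kinks d (T : measurableType d) (P : probability T R) (Z : I -> T -> R) :
  iid_std_normal P Z -> iid_null P Z kinks.
Proof.
move=> iZ; pose C : countType := (cone (p := p) * 'I_p * rat * rat)%type.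
pose F (e : C) : set (rvec R I) :=
  if (0 < e.1.2) && (e.1.2 < e.2) then kink e.1.1.1 e.1.1.2 e.1.2 e.2 else set0.
pose G (m : nat) : set (rvec R I) := if unpickle m is Some e then F e else set0.
have nF e : iid_null P Z (F e).
  rewrite /F; case: ifP => [/andP[q1 q12]|_]; first exact: null_kink.
  by split=> //; rewrite preimage_set0 measure0.
have nG (m : nat) : iid_null P Z (G m).
  by rewrite /G; case: unpickle => // ; split=> //; rewrite preimage_set0 measure0.
have -> : kinks = \bigcup_m G m.
  apply/seteqP; split=> x.
    move=> [g [k [q1 [q2 [q10 q12 K]]]]]; pose e : C := (g, k, q1, q2).
    have [N NE] : exists N : nat, unpickle N = Some e by exists (pickle e); exact: pickleK.
    by exists N; [exact: Logic.I|rewrite /G NE /F/= q10 q12].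
  move=> [m _]; rewrite /G; case: unpickle => // -[[[g k] q1] q2]; rewrite /F/=.
  by case: ifP => // /andP[q10 q12] K; exists g, k, q1, q2.
have mG (m : nat) : measurable (G m) by have [] := nG m.
have G0 (m : nat) : P (joint Z @^-1` G m) = 0%E by have [] := nG m.
have mZG (m : nat) : measurable (joint Z @^-1` G m).
  exact: (measurable_preimage (measurable_joint iZ) (mG m)).
split; first exact: (bigcupT_measurable _ mG).
rewrite preimage_bigcup; apply/negligibleP; first exact: (bigcupT_measurable _ mZG).
by apply: negligible_bigcup => m; apply/negligibleP; [exact: mZG|exact: G0].
Qed.

End uniqueness.

(** * Measurability of the minimizer *)

Section rV_continuity.
Import numFieldNormedType.Exports.

Lemma norm_coord_le {R : realType} (p : nat) (v : 'rV[R]_p) (j : 'I_p) :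
  `|v 0 j| <= `|v|.
Proof.
have /mapP[e He ->] : `|v 0 j| \in [seq `|v x.1 x.2| | x : 'I_1 * 'I_p].
  by apply/mapP; exists (ord0, j) => //=; rewrite mem_enum.
by rewrite [leRHS]/Num.norm /= mx_normrE; apply/bigmax_geP; right => /=; exists e.
Qed.

Lemma lipschitz_rV_continuous {R : realType} (p : nat) (f : 'rV[R]_p -> R) (L : R) :
  0 <= L -> (forall v w, f w <= f v + L * \sum_j `|w 0 j - v 0 j|) -> continuous f.
Proof.
move=> L0 fL v; apply/(@cvgrPdist_lt _ _ _ (nbhs v) (nbhs_filter v)) => e e0.
pose M := L * p%:R + 1; have M0 : 0 < M by rewrite ltr_wpDl// mulr_ge0.
have sumle (w w' : 'rV[R]_p) : \sum_j `|w 0 j - w' 0 j| <= p%:R * `|w - w'|.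
  have -> : p%:R * `|w - w'| = \sum_(j < p) `|w - w'| by rewrite sumr_const card_ord mulr_natl.
  apply: ler_sum => j _.
  by have := norm_coord_le (w - w') j; rewrite !mxE.
near=> w.
have vw : `|v - w| < e / M by near: w; apply: cvgr_dist_lt => //; rewrite divr_gt0.
have key : L * (p%:R * `|v - w|) < e.
  apply: (@le_lt_trans _ _ (M * `|v - w|)).
    by rewrite mulrA ler_wpM2r// /M lerDl.
  by rewrite mulrC -ltr_pdivlMr.
have h1 : f w <= f v + L * (p%:R * `|v - w|).
  apply: (le_trans (fL v w)); rewrite lerD2l ler_wpM2l// distrC.
  by rewrite -normrN opprB in vw *; exact: sumle.
have h2 : f v <= f w + L * (p%:R * `|v - w|).
  by apply: (le_trans (fL w v)); rewrite lerD2l ler_wpM2l// sumle.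
by rewrite ltr_norml; lra.
Unshelve. all: by end_near. Qed.

End rV_continuity.

Section borel_version.
Import numFieldNormedType.Exports.
Context {R : realType} {n p : nat}.
Let I : finType := ('I_n * 'I_p + 'I_n)%type.
Variables (c : R) (lam : nat -> R).
Hypothesis c_ge0 : 0 <= c.
Hypothesis lam_decr : forall k, lam k.+1 <= lam k.
Hypothesis lam_ge0 : forall k, 0 <= lam k.
Hypothesis lam_gt0 : 0 < lam p.-1.
Implicit Types (x : rvec R I) (b : 'cV[R]_p).

Let ob x b := obj c lam x b.

Let L x : R := c * (\sum_r \sum_j `|design x r j|) + 2 * lam 0%N.

Let L_ge0 x : 0 <= L x.
Proof.
by rewrite addr_ge0// mulr_ge0// sumr_ge0// => r _; apply: sumr_ge0.
Qed.

Lemma obj_lipschitz x b b' : ob x b' <= ob x b + L x * \sum_j `|b' j 0 - b j 0|.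
Proof.
pose D := b' - b; have DE : b' = b + D by rewrite /D subrKC.
have -> : \sum_j `|b' j 0 - b j 0| = \sum_j `|D j 0| by apply: eq_bigr => j _; rewrite !mxE.
rewrite DE /ob /obj; have -> : response x - design x *m (b + D) =
    response x - design x *m b - design x *m D by rewrite mulmxDr opprD addrA.
rewrite /L [X in _ <= _ + X]mulrDl [in leRHS]addrACA; apply: lerD.
  rewrite -mulrA -mulrDr ler_wpM2l//; apply: (le_trans (norm2D _ _)); rewrite lerD2l.
  apply: (le_trans (norm2_le_sum _)); rewrite mulr_suml; apply: ler_sum => r _.
  rewrite !mxE normrN; apply: (le_trans (ler_norm_sum _ _ _)).
  rewrite mulr_suml; apply: ler_sum => j _; rewrite normrM ler_wpM2l//.
  by rewrite (bigD1 j)//= lerDl sumr_ge0.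
rewrite -mulrA -mulrDr ler_wpM2l//; apply: (le_trans (penD lam_decr lam_ge0 _ _)).
by rewrite lerD2l; exact: pen_le.
Qed.

Definition ratv (q : {ffun 'I_p -> rat}) : 'cV[R]_p := \col_i ratr (q i).

Lemma ratv_approx x b (e : R) : 0 < e ->
  exists q, ob x (ratv q) < ob x b + e /\ forall i, `|ratv q i 0 - b i 0| < e.
Proof.
move=> e0; pose M := L x * p%:R + 1.
have M0 : 0 < M by rewrite ltr_wpDl// mulr_ge0.
have M1 : 1 <= M by rewrite lerDr mulr_ge0.
have [q qP] := rat_approx (fun i => b i 0) (divr_gt0 e0 M0 : 0 < e / M).
have d i : 0 <= ratv q i 0 - b i 0 < e / M.
  by have /andP[h1 h2] := qP i; rewrite mxE subr_ge0 (ltW h1) ltrBlDl.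
have d' i : `|ratv q i 0 - b i 0| < e / M by have /andP[h1 h2] := d i; rewrite ger0_norm.
exists q; split=> [|i]; last first.
  by apply: (lt_le_trans (d' i)); rewrite ler_pdivrMr// ler_peMr// ltW.
apply: (le_lt_trans (obj_lipschitz x b (ratv q))); rewrite ltrD2l.
apply: (@le_lt_trans _ _ (L x * (p%:R * (e / M)))).
  have -> : p%:R * (e / M) = \sum_(j < p) (e / M) by rewrite sumr_const card_ord mulr_natl.
  by rewrite ler_wpM2l//; apply: ler_sum => j _; exact: ltW.
rewrite mulrA mulrA ltr_pdivrMr// mulrC ltr_pM2l// /M; lra.
Qed.

Lemma measurable_obj b : measurable_fun setT (fun x => ob x b).
Proof.
rewrite /ob /obj; apply: measurable_funD => //; apply: measurable_funM => //.
rewrite (_ : (fun x => _) = (fun x => norm2 (\col_r (x (inr r) - \sum_j x (inl (r, j)) * b j 0)))).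
  apply: measurable_norm2_col => r; apply: measurable_funB.
    exact: (measurable_coord (inr r : I)).
  apply: measurable_sum => j; apply: measurable_funM => //.
  exact: (measurable_coord (inl (r, j) : I)).
apply/funext => x; congr norm2; apply/matrixP => r j; rewrite ord1 !mxE; congr (_ - _).
by apply: eq_bigr => k _; rewrite mxE.
Qed.

Variable est : rvec R I -> 'cV[R]_p.
Hypothesis est_min : forall x, minimizer c lam x (est x).

(** The minimal value does not depend on which minimizer [est] selects; it is an infimum over the
    countably many rational vectors. *)
Lemma measurable_min_obj : measurable_fun setT (fun x => ob x (est x)).
Proof.
apply: measurable_fun_ltP => r.
rewrite [X in measurable X](_ : _ = \bigcup_(q : {ffun 'I_p -> rat})
    (fun x => ob x (ratv q)) @^-1` `]-oo, r[%classic).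
  apply: countable_bigcupT_measurable; first exact: countableP.
  by move=> q; apply: measurable_preimage; [exact: measurable_obj|exact: measurable_itv].
apply/seteqP; split=> x /=.
  move=> xr; have e0 : 0 < r - ob x (est x) by rewrite subr_gt0.
  have [q [qr _]] := ratv_approx x (est x) e0; exists q => //=.
  by rewrite in_itv/=; move: qr; rewrite addrC subrK.
by move=> [q _ /=]; rewrite in_itv/=; apply: le_lt_trans; exact: est_min.
Qed.

(** Near-minimizers lie in a compact box, so near-minimality within the closed half-space
    [b i 0 <= r] produces an exact minimizer there. *)
Lemma minimizer_compact x i (r : R) :
  (forall N : nat, exists b, b i 0 <= r /\ ob x b < ob x (est x) + N.+1%:R^-1) ->
  exists b, b i 0 <= r /\ minimizer c lam x b.
Proof.
(* A point within 1 of the minimum has a penalty term at most the minimum plus 1, and [pen_ge_coord]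
   converts this into the bound [M] on each coordinate. The constraint on coordinate [i] is built
   into the box. *)
move=> H; pose M := (ob x (est x) + 1) / (2 * lam p.-1).
have lam20 : 0 < 2 * lam p.-1 by rewrite mulr_gt0.
have bM b j : ob x b < ob x (est x) + 1 -> `|b j 0| <= M.
  move=> bo; rewrite ler_pdivlMr//; apply: ltW; apply: le_lt_trans bo.
  apply: (@le_trans _ _ (2 * pen lam b)); last by rewrite lerDr mulr_ge0 ?norm2_ge0.
  by rewrite mulrC -mulrA ler_wpM2l// pen_ge_coord.
pose A (j : 'I_p) : set R := `[- M, if j == i then Num.min M r else M]%classic.
pose K : set 'rV[R]_p := [set v | forall j, A j (v ord0 j)].
have inK b : b i 0 <= r -> ob x b < ob x (est x) + 1 -> K b^T.
  move=> bir bo j; rewrite /A /= in_itv/= mxE.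
  have := bM b j bo; rewrite ler_norml => /andP[-> b2] /=.
  by case: eqP => // ->; rewrite le_min bir andbT; have := bM b i bo; rewrite ler_norml => /andP[].
have cK : compact K by apply: rV_compact => j; exact: segment_compact.
have [b0 [b0r b0o]] := H 0%N.
have K0 : K !=set0 by exists b0^T; apply: inK => //; rewrite invr1 in b0o.
have cf : continuous (fun v : 'rV[R]_p => ob x v^T).
  apply: (lipschitz_rV_continuous (L_ge0 x)) => v w.
  apply: (le_trans (obj_lipschitz x v^T w^T)); rewrite lerD2l ler_wpM2l//.
  by apply: ler_sum => j _; rewrite !mxE.
have [v vK vmin] := EVT_min_rV K0 cK (continuous_subspaceT cf).
have vK' : K v by rewrite inE in vK.
exists v^T; split.
  have := vK' i; rewrite /A eqxx /= in_itv/= mxE => /andP[_].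
  by rewrite le_min => /andP[].
move=> b'; apply: (le_trans _ (est_min x b')).
rewrite leNgt; apply/negP => lt1.
pose d := ob x v^T - ob x (est x); have d0 : 0 < d by rewrite subr_gt0.
have [N Nd] : exists N : nat, N.+1%:R^-1 < d.
  exists (Num.truncn d^-1); rewrite invf_plt ?posrE//.
  exact: truncnS_gt.
have [b [br bo]] := H N.
have bK : b^T \in K.
  rewrite inE; apply: inK => //; apply: lt_le_trans bo _; rewrite lerD2l.
  by rewrite invf_le1// ler1n.
have := vmin _ bK; rewrite trmxK; apply/negP; rewrite -ltNge.
by apply: lt_trans bo _; rewrite -ltrBrDl.
Qed.

Definition borel_est x (i : 'I_p) : R :=
  if `[< kinks c lam x >] then 0 else est x i 0.

Lemma borel_estE x i : ~ kinks c lam x -> borel_est x i = est x i 0.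
Proof. by move=> nk; rewrite /borel_est; case: asboolP. Qed.

(** Off the kinks, [est x i 0 < r] holds iff for some rational [r' < r] the minimum is approached
    arbitrarily well by rational vectors with [i]-th coordinate at most [r']. Conversely to the
    density argument, compactness turns such vectors into a minimizer with that coordinate at most
    [r'], and uniqueness identifies it with [est x]. *)
Lemma measurable_borel_est i : measurable (kinks c lam : set (rvec R I)) ->
  measurable_fun setT (fun x => borel_est x i).
Proof.
move=> mk; apply: measurable_fun_ltP => r.
pose S : set (rvec R I) := \bigcup_(r' in [set r' : rat | ratr r' < r])
  \bigcap_(N in [set: nat]) \bigcup_(q in [set q | ratv q i 0 <= ratr r'])
    [set x | ob x (ratv q) < ob x (est x) + N.+1%:R^-1].
have mS : measurable S.
  rewrite /S bigcup_mkcond; apply: bigcupT_measurable_rat => r'; case: ifP => // _.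
  apply: bigcap_measurableType => N _.
  rewrite bigcup_mkcond; apply: countable_bigcupT_measurable; first exact: countableP.
  move=> q; case: ifP => // _.
  rewrite (_ : [set x | _] =
      (fun x => ob x (ratv q) < ob x (est x) + N.+1%:R^-1) @^-1` [set true])//.
  apply: measurable_preimage => //; apply: measurable_fun_ltr; first exact: measurable_obj.
  by apply: measurable_funD => //; exact: measurable_min_obj.
rewrite [X in measurable X](_ : _ = (kinks c lam `&` [set _ | 0 < r]) `|` (~` kinks c lam `&` S)).
  apply: measurableU; apply: measurableI => //; last exact: measurableC.
  have [r0|r0] := boolP (0 < r).
    by rewrite [X in measurable X](_ : _ = setT)//; apply/seteqP; split.
  by rewrite [X in measurable X](_ : _ = set0)//; apply/seteqP; split=> x //=; rewrite (negbTE r0).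
apply/seteqP; split=> x /=; rewrite /borel_est.
  case: asboolP => [kx r0|nkx er]; first by left.
  right; split=> //.
  have [r'] := rat_in_itvoo er; rewrite in_itv/= => /andP[er' r'r].
  exists r' => // N _.
  pose e := Num.min (ratr r' - est x i 0) N.+1%:R^-1.
  have e0 : 0 < e by rewrite lt_min subr_gt0 er' invr_gt0 ltr0n.
  have [q [qo qi]] := ratv_approx x (est x) e0; exists q => /=.
    have := qi i; rewrite lt_min => /andP[+ _]; rewrite ltr_norml => /andP[_ h].
    by lra.
  by apply: (lt_le_trans qo); rewrite lerD2l ge_min lexx orbT.
case=> [[kx r0]|[nkx [r' r'r H]]]; case: asboolP => // _.
have [b [br bm]] : exists b, b i 0 <= ratr r' /\ minimizer c lam x b.
  apply: minimizer_compact => N; have [q qr qo] := H N Logic.I.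
  by exists (ratv q).
apply: le_lt_trans r'r; rewrite (_ : est x = b)//; apply/eqP; apply: contrapT => /negP eb.
by apply: nkx; exact: (minimizers_kink c_ge0 lam_decr lam_ge0 lam_gt0 (est_min x) bm eb).
Qed.

End borel_version.

(** * Measurability of the threshold and of the selector *)

Section measurable_selector.
Context {R : realType} d (T : measurableType d).

(** The inverse is discontinuous at 0, where its value is 0 by convention; on non-negative numbers
    it coincides with the power of exponent -1, a measurable function. *)
Lemma measurable_inv_ge0 (f : T -> R) : (forall w, 0 <= f w) ->
  measurable_fun setT f -> measurable_fun setT (fun w => (f w)^-1).
Proof.
move=> f0 mf; rewrite (_ : (fun w => _) = (fun w => f w `^ (-1))); last first.
  by apply/funext => w; rewrite powR_inv1.
exact: (measurableT_comp (measurable_powR _) mf).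
Qed.

Lemma measurable_norm2 n (u : T -> 'cV[R]_n) :
  (forall k, measurable_fun setT (fun w => u w k 0)) ->
  measurable_fun setT (fun w => norm2 (u w)).
Proof.
move=> mu; have := measurable_norm2_col mu.
by congr measurable_fun; apply/funext => w; congr norm2; apply/matrixP => i j; rewrite ord1 !mxE.
Qed.

Lemma measurable_threshold n (sig' a : R) (p s : nat) (u : T -> 'cV[R]_n) :
  0 < a -> (forall k, measurable_fun setT (fun w => u w k 0)) ->
  measurable_fun setT (fun w => threshold sig' a p s (u w)).
Proof.
move=> a0 mu; have mn := measurable_norm2 mu; rewrite /threshold.
apply: measurable_funD; first by do 2 apply: measurable_funM => //.
apply: measurable_funM => //; apply: measurable_inv_ge0.
  by move=> w; rewrite mulr_ge0 ?norm2_ge0// ltW.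
by apply: measurable_funM.
Qed.

Definition residual_corr {n p : nat} (X : 'M[R]_(n, p)) (Y : 'cV[R]_n)
    (bh : 'cV[R]_p) (i : 'I_p) : R :=
  ((col i X)^T *m (Y - \sum_(j < p | j != i) (bh j 0 *: col j X))) 0 0.

Lemma residual_corrE {n p : nat} (X : 'M[R]_(n, p)) (Y : 'cV[R]_n)
    (bh : 'cV[R]_p) (i : 'I_p) :
  residual_corr X Y bh i =
  \sum_k X k i * (Y k 0 - \sum_(j < p | j != i) bh j 0 * X k j).
Proof.
rewrite /residual_corr mxE; apply: eq_bigr => k _; rewrite !mxE; congr (_ * (_ - _)).
by rewrite summxE; apply: eq_bigr => j _; rewrite !mxE.
Qed.

Lemma measurable_selector n p (sig' a : R) (s : nat) (X : T -> 'M[R]_(n, p))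
    (Y : T -> 'cV[R]_n) (bh : T -> 'cV[R]_p) (i : 'I_p) : 0 < a ->
  (forall k j, measurable_fun setT (fun w => X w k j)) ->
  (forall k, measurable_fun setT (fun w => Y w k 0)) ->
  (forall j, measurable_fun setT (fun w => bh w j 0)) ->
  measurable_fun setT (fun w => selector sig' a s (X w) (Y w) (bh w) i).
Proof.
move=> a0 mX mY mb.
have mcol k : measurable_fun setT (fun w => col i (X w) k 0).
  by under eq_fun do rewrite mxE; exact: mX.
apply: measurable_fun_ltr; first exact: measurable_threshold.
apply: measurable_funM.
  apply: measurableT_comp => //.
  rewrite (_ : (fun w => _) = (fun w => residual_corr (X w) (Y w) (bh w) i))//.
  under eq_fun do rewrite residual_corrE.
  apply: measurable_sum => k; apply: measurable_funM => //; apply: measurable_funB => //.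
  by apply: measurable_sum_cond => j; exact: measurable_funM.
apply: measurable_inv_ge0; last exact: measurable_norm2.
by move=> w; exact: norm2_ge0.
Qed.

End measurable_selector.

(** * Square-Root SLOPE as an instance of the penalized problem *)

Section slope.
Context {R : realType} {n1 n2 p : nat}.
Let I : finType := ('I_n1 * 'I_p + 'I_n1)%type.
Variables (A sigma : R) (b : 'cV[R]_p) (bhat : 'M[R]_(n1, p) -> 'cV[R]_n1 -> 'cV[R]_p).
Hypothesis A_gt0 : 0 < A.
Hypothesis sigma_gt0 : 0 < sigma.
Hypothesis p_gt0 : (0 < p)%N.
Hypothesis bhatP : is_sqrt_slope A (n1 + n2) bhat.
Hypothesis n1_gt0 : (0 < n1)%N.

Let lam k := slope_lambda A (n1 + n2) p k.+1.

Let n_gt0 : 0 < (n1 + n2)%:R :> R.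
Proof. by rewrite ltr0n addn_gt0 n1_gt0. Qed.

Lemma slope_lambda_decr k : lam k.+1 <= lam k.
Proof.
rewrite /lam /slope_lambda (ler_wpM2l (ltW A_gt0))//; apply: ler_wsqrtr.
rewrite ler_wpM2r// ?invr_ge0 ?ler0n//.
have p2 : 0 < 2 * p%:R :> R by rewrite mulr_gt0// ltr0n.
rewrite ler_ln ?posrE ?divr_gt0// ler_pM2l// lef_pV2 ?posrE// ler_nat.
exact: leqnSn.
Qed.

Lemma slope_lambda_ge0 k : 0 <= lam k.
Proof. by rewrite mulr_ge0 ?sqrtr_ge0 ?ltW. Qed.

(** At [j = p] the logarithm is [ln 2]: the factor 2 in [2p/j] keeps the last weight positive, which
    uniqueness and compactness both rely on. *)
Lemma slope_lambda_gt0 : 0 < lam p.-1.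
Proof.
rewrite mulr_gt0// sqrtr_gt0 divr_gt0// ln_gt0// prednK//.
by rewrite mulfK ?ltr1n// pnatr_eq0 -lt0n.
Qed.

Lemma sqrt_slope_objE (x : rvec R I) (b' : 'cV[R]_p) :
  sqrt_slope_obj A (n1 + n2) (design x) (response x) b' =
  obj (Num.sqrt n1%:R)^-1 lam x b'.
Proof. by rewrite /sqrt_slope_obj /obj mulrC. Qed.

(** Passes from the coordinates (design, noise) to (design, response). *)
Definition to_response (x : rvec R I) : rvec R I :=
  fun e => if e is inr r then sigma * x e + \sum_j x (inl (r, j)) * b j 0 else x e.

Lemma response_to_response x :
  response (to_response x) = design x *m b + sigma *: response x.
Proof.
apply/matrixP => r j; rewrite ord1 !mxE addrC; congr (_ + _).
by apply: eq_bigr => k _; rewrite mxE.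
Qed.

Lemma design_to_response x : design (to_response x) = design x.
Proof. by apply/matrixP => r j; rewrite !mxE. Qed.

Lemma measurable_to_response : measurable_fun setT to_response.
Proof.
apply: measurable_rvec => -[e|r] /=; first exact: (measurable_coord (inl e : I)).
apply: measurable_funD.
  by apply: measurable_funM => //; exact: (measurable_coord (inr r : I)).
apply: measurable_sum => j; apply: measurable_funM => //.
exact: (measurable_coord (inl (r, j) : I)).
Qed.

Lemma null_to_response d (T : measurableType d) (P : probability T R) (Z : I -> T -> R)
    (B : set (rvec R I)) : iid_std_normal P Z ->
  iid_null P Z B -> iid_null P Z (to_response @^-1` B).
Proof.
move=> iZ nB.
pose K : {set I} := [set e | if e is inr r then true else false]%SET.
pose h (e : I) (x : rvec R I) : R :=
  if e is inr r then \sum_j x (inl (r, j)) * b j 0 else 0.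
have mh e : measurable_fun setT (h e).
  case: e => [e|r]; rewrite /h//; apply: measurable_sum => j; apply: measurable_funM => //.
  exact: (measurable_coord (inl (r, j) : I)).
have hK e (x y : rvec R I) : (forall j, j \notin K -> x j = y j) -> h e x = h e y.
  by case: e => [//|r] /= xy; apply: eq_bigr => j _; rewrite xy// inE.
have := null_batch iZ sigma_gt0 mh hK nB; congr iid_null.
by apply/funext => x /=; congr B; apply/funext => -[e|r] /=; rewrite inE.
Qed.

Lemma slope_borel d (T : measurableType d) (P : probability T R) (Z : I -> T -> R) :
  iid_std_normal P Z ->
  exists (bt : rvec R I -> 'cV[R]_p) (N : set (rvec R I)),
    [/\ forall i, measurable_fun setT (fun x => bt x i 0), iid_null P Z N &
     forall x, ~ N x -> bt x = bhat (design x) (design x *m b + sigma *: response x)].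
Proof.
move=> iZ; pose c : R := (Num.sqrt n1%:R)^-1.
have c0 : 0 <= c by rewrite invr_ge0 sqrtr_ge0.
pose est (x : rvec R I) := bhat (design x) (response x).
have est_min x : minimizer c lam x (est x).
  by move=> b'; rewrite -!sqrt_slope_objE; exact: bhatP.
(* The kinks are null when design and response are i.i.d. normal; the actual response is not, and
   pulling back along [to_response] accounts for this. *)
have [mk k0] := null_kinks (lam := lam) c0 slope_lambda_ge0 iZ.
exists (fun x => \col_i borel_est c lam est (to_response x) i).
exists (to_response @^-1` kinks c lam); split.
- move=> i; under eq_fun do rewrite mxE.
  have mb := measurable_borel_est c0 slope_lambda_decr slope_lambda_ge0 slope_lambda_gt0 est_min i mk.
  exact: (measurableT_comp mb measurable_to_response).
- exact: null_to_response.
- move=> x nx; apply/matrixP => i j; rewrite ord1 mxE borel_estE//.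
  by rewrite /est response_to_response design_to_response.
Qed.

End slope.

(** * Errors of the selector *)

Section normal_tails.
Context {R : realType}.
Local Notation N01 := (normal_prob (0 : R) 1).

Let mlt (c x : R) : measurable [set y : R | x < c * y].
Proof.
rewrite (_ : [set y | _] = (fun y => c * y) @^-1` `]x, +oo[%classic).
  by apply: measurable_preimage; [exact: measurable_funM|exact: measurable_itv].
by apply/seteqP; split=> y /=; rewrite in_itv/= andbT.
Qed.

Let mopp (B : set R) : measurable B -> measurable (-%R @^-1` B).
Proof. by move=> mB; exact: measurable_preimage. Qed.

Lemma normal01_opp (B : set R) : measurable B -> N01 (-%R @^-1` B) = N01 B.
Proof. by move=> mB; exact: normal_prob_opp (oner_neq0 R) mB. Qed.

Lemma normal01_half (c : R) : 0 < c -> (1 <= 2%:E * N01 [set y | (0 < c * y)%R])%E.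
Proof.
move=> c0.
have E : [set y : R | 0 < c * y] = [set y | 0 < y].
  by apply/seteqP; split=> y /=; rewrite pmulr_rgt0.
have mp : measurable [set y : R | 0 < y] by rewrite -E.
have N0 : N01 [set 0] = 0%E.
  have /null_content_dominatesP := @normal_prob_dominates R 0 1; apply => //.
  exact: lebesgue_measure_set1.
rewrite E -(probability_setT N01).
rewrite (_ : setT = [set y | 0 < y] `|` (-%R @^-1` [set y | 0 < y] `|` [set 0])); last first.
  apply/seteqP; split=> y //= _.
  by have [y0|y0|->] := ltgtP 0 y; [left|right; left; rewrite oppr_gt0|right; right].
have mn : measurable (-%R @^-1` [set y : R | 0 < y]) by exact: measurable_preimage.
have m0 : measurable [set 0 : R] by [].
have m1 : measurable (-%R @^-1` [set y : R | 0 < y] `|` [set 0]) by exact: measurableU.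
apply: (le_trans (measureU2 N01 mp m1)).
have -> : (2%:E * N01 [set y | (0 < y)%R] = N01 [set y | (0 < y)%R] + N01 [set y | (0 < y)%R])%E.
  by rewrite -mule2n mule_natl.
apply: leeD => //; apply: (le_trans (measureU2 N01 mn m0)).
by rewrite [X in (_ + X)%E]N0 adde0 [leLHS]normal01_opp.
Qed.

Lemma normal01_two_sided (v v' x : R) : 0 < v -> v <= v' -> 0 <= x ->
  (N01 [set y | (x < `|v * y|)%R] <= 2%:E * N01 [set y | (x < v' * y)%R])%E.
Proof.
move=> v0 vv' x0.
have v'0 : 0 < v' by exact: lt_le_trans vv'.
have mn := mopp (mlt v' x).
have -> : (2%:E * N01 [set y | (x < v' * y)%R] =
    N01 [set y | (x < v' * y)%R] + N01 (-%R @^-1` [set y | (x < v' * y)%R]))%E.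
  by rewrite normal01_opp// -mule2n mule_natl.
apply: le_trans (measureU2 N01 (mlt v' x) mn); apply: le_measure; rewrite ?inE.
- rewrite (_ : [set y | _] = [set y | x < v * y] `|` (-%R @^-1` [set y : R | x < v * y])).
    by apply: measurableU; [exact: mlt|exact: (mopp (mlt v x))].
  by apply/seteqP; split=> y /=; rewrite mulrN lter_normr => /orP.
- by apply: measurableU; [exact: mlt|].
- have bound z : x < v * z -> x < v' * z.
    move=> xz; apply: (lt_le_trans xz); rewrite ler_wpM2r// -(pmulr_rge0 _ v0).
    exact: le_trans (ltW xz).
  move=> y /=; rewrite lter_normr => /orP[xy|]; [left|rewrite -mulrN => xy; right];
    exact: bound.
Qed.

(** A miss forces the noise to reach [l - x] in the direction opposite to [m]. If [l - x > 0], one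
    tail suffices, and the strict [v < v'] turns the weak inequality into a strict one. If [l <= x],
    the tail at 0 is one half, and twice it covers any probability. *)
Lemma normal01_shifted (v v' x l m : R) : 0 < v -> v < v' -> l <= `|m| ->
  (N01 [set y | (`|m + v * y| <= x)%R] <=
   2%:E * N01 [set y | (Num.max (l - x) 0 < v' * y)%R])%E.
Proof.
move=> v0 vv' lm.
have v'0 : 0 < v' by exact: lt_trans vv'.
have mS : measurable [set y : R | `|m + v * y| <= x].
  rewrite (_ : [set y | _] = (fun y => m + v * y) @^-1` `[-x, x]%classic).
    apply: measurable_preimage; last exact: measurable_itv.
    by apply: measurable_funD => //; exact: measurable_funM.
  by apply/seteqP; split=> y /=; rewrite in_itv/= ler_norml.
have [lx|lx] := leP (l - x) 0.
  apply: le_trans (normal01_half v'0); exact: probability_le1.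
have key : (N01 [set y | (`|m + v * y| <= x)%R] <= N01 [set y | (l - x < v' * y)%R])%E.
  have bound y : l - x <= v * y -> l - x < v' * y.
    move=> h; apply: (le_lt_trans h); rewrite ltr_pM2r// -(pmulr_rgt0 _ v0).
    exact: lt_le_trans h.
  have [m0|m0] := leP 0 m.
    rewrite -(normal01_opp (mlt v' (l - x))); apply: le_measure; rewrite ?inE//.
      exact: (mopp (mlt v' (l - x))).
    move=> y /=; rewrite ger0_norm// in lm; rewrite ler_norml => /andP[h1 h2].
    by apply: bound; rewrite mulrN; lra.
  apply: le_measure; rewrite ?inE; [exact: mS|exact: mlt|move=> y /=].
  rewrite ltr0_norm// in lm; rewrite ler_norml => /andP[h1 h2].
  by apply: bound; lra.
apply: (le_trans key); rewrite -[leLHS]mul1e; apply: lee_wpmul2r => //.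
by rewrite lee_fin ler1n.
Qed.

End normal_tails.

Section psi_term.
Context {R : realType} d (T : measurableType d) (P : probability T R)
  d' (T' : measurableType d') (Q : probability T' R).
Context {n : nat} (U : 'I_n -> T -> R) (eps : T' -> R) (zeta : 'I_n -> T' -> R).
Hypothesis iidU : iid_std_normal P U.
Hypothesis iidQ : iid_std_normal Q (eps_zeta eps zeta).
Variables (thr : 'cV[R]_n -> R) (c : R).
Hypothesis mthr : measurable_fun setT (fun x : rvec R 'I_n => thr (\col_k x k)).

Let S : set (T * R) := [set z | thr (\col_k U k z.1) < c * z.2].

Let mS : measurable S.
Proof.
rewrite (_ : S = (fun z : T * R => thr (\col_k U k z.1) < c * z.2) @^-1` [set true]).
  apply: measurable_preimage => //; apply: measurable_fun_ltr.
    exact: (measurableT_comp mthr (measurableT_comp (measurable_joint iidU) measurable_fst)).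
  by apply: measurable_funM => //; exact: measurable_snd.
by apply/seteqP; split.
Qed.

Lemma measurable_cond_tail : measurable_fun setT (fun w =>
  normal_prob 0 1 [set y | (thr (\col_k U k w) < c * y)%R]).
Proof.
rewrite (_ : (fun w => _) = normal_prob 0 1 \o xsection S).
  exact: (@measurable_fun_xsection _ _ T (measurableTypeR R) R (normal_prob 0 1) _ mS).
by apply/funext => w /=; congr (normal_prob _ _ _); apply/seteqP; split=> t;
  rewrite /xsection /= in_setE.
Qed.

(** The pair in psi is realized on [P \x Q], with the column from [P] and the noise from [Q];
    integrating the normal tail over the column then gives the probability on [Q]. *)
Lemma cond_tailE :
  (\int[P]_w normal_prob 0 1 [set y | (thr (\col_k U k w) < c * y)%R] =
   Q [set w | (thr (\col_k zeta k w) < c * eps w)%R])%E.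
Proof.
pose H : set (rvec R (option 'I_n)) :=
  [set x | thr (\col_k x (Some k)) < c * x None].
have mH : measurable H.
  rewrite (_ : H = (fun x : rvec R (option 'I_n) => thr (\col_k x (Some k)) < c * x None) @^-1` [set true]).
    apply: measurable_preimage => //; apply: measurable_fun_ltr.
      have mp : measurable_fun setT (fun x : rvec R (option 'I_n) => (fun k => x (Some k)) : rvec R 'I_n).
        by apply: measurable_rvec => k; exact: (measurable_coord (Some k)).
      exact: (measurableT_comp mthr mp).
    by apply: measurable_funM => //; exact: (measurable_coord None).
  by apply/seteqP; split.
pose f (k : option 'I_n) : 'I_n + option 'I_n := if k is Some k then inl k else inr None.
have injf : injective f by move=> [k|] [k'|] //= [->].
rewrite -[RHS]/(Q (joint (eps_zeta eps zeta) @^-1` H)).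
rewrite (iid_law iidQ (iid_reindex injf (iid_sum iidU iidQ)) mH).
rewrite /= /product_measure1; apply: eq_integral => w _ /=.
have msl : measurable [set y | thr (\col_k U k w) < c * y].
  have := measurable_xsection w mS.
  by congr measurable; apply/seteqP; split=> t; rewrite /xsection /= in_setE.
rewrite -(iid_coord iidQ None msl); congr (Q _); apply/seteqP; split=> w' /=;
  by rewrite /xsection /= in_setE.
Qed.

End psi_term.

Lemma sum_pairE {R : realType} {n p : nat} (F : 'I_n * 'I_p -> R) :
  \sum_e F e = \sum_k \sum_j F (k, j).
Proof. by rewrite pair_bigA; apply: eq_bigr => -[k j] _. Qed.

(** * Error of one coordinate for a fixed estimate *)

Section selector_error.
Context {R : realType} d (T : measurableType d) (P : probability T R)
  d' (T' : measurableType d') (Q : probability T' R).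
Context {n p : nat}.
Let I : finType := ('I_n * 'I_p + 'I_n)%type.
Variables (Z : I -> T -> R) (eps : T' -> R) (zeta : 'I_n -> T' -> R).
Hypothesis iidZ : iid_std_normal P Z.
Hypothesis iidQ : iid_std_normal Q (eps_zeta eps zeta).
Variables (s : nat) (sigma a delta : R) (b : 'cV[R]_p).
Hypothesis sigma_gt0 : 0 < sigma.
Hypothesis a_gt0 : 0 < a.
Hypothesis s_gt0 : (1 <= s)%N.
Hypothesis sp : (2 * s <= p)%N.
Hypothesis bP : in_Omega s a b.

Let sig' := sigma * Num.sqrt (1 + delta ^+ 2).

Definition selector_err (bh : 'cV[R]_p) (i : 'I_p) (y : rvec R I) : bool :=
  selector sig' a s (design y) (design y *m b + sigma *: response y) bh i
    != eta_supp b i.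

Definition err_threshold (i : 'I_p) (u : 'cV[R]_n) : R :=
  if eta_supp b i then Num.max (a * norm2 u - threshold sig' a p s u) 0
  else threshold sig' a p s u.

(** Here [s <= p/2] enters: the threshold is then at least half of [a * norm2 u], so it is
    non-negative and the tail of an inactive coordinate does not exceed that of an active one. *)
Lemma log_ratio_ge0 : 0 <= ln (p%:R / s%:R - 1) :> R.
Proof.
rewrite ln_ge0// lerBrDr ler_pdivlMr ?ltr0n//.
by rewrite (_ : (1 + 1) * s%:R = (2 * s)%:R) ?ler_nat// natrM.
Qed.

Lemma threshold_ge (u : 'cV[R]_n) : a * norm2 u / 2 <= threshold sig' a p s u.
Proof.
rewrite /threshold lerDl; apply: mulr_ge0; first by rewrite mulr_ge0 ?sqr_ge0 ?log_ratio_ge0.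
by rewrite invr_ge0 mulr_ge0 ?norm2_ge0// ltW.
Qed.

Lemma threshold_ge0 (u : 'cV[R]_n) : 0 <= threshold sig' a p s u.
Proof.
by apply: le_trans (threshold_ge u); rewrite divr_ge0// mulr_ge0 ?norm2_ge0// ltW.
Qed.

Lemma measurable_err_threshold i :
  measurable_fun setT (fun x : rvec R 'I_n => err_threshold i (\col_k x k)).
Proof.
have mc k : measurable_fun setT (fun x : rvec R 'I_n => (\col_k x k : 'cV[R]_n) k 0).
  by under eq_fun do rewrite mxE; exact: measurable_coord.
rewrite /err_threshold; case: (eta_supp b i); last exact: measurable_threshold.
apply: measurable_maxr => //; apply: measurable_funB; last exact: measurable_threshold.
by apply: measurable_funM => //; exact: measurable_norm2.
Qed.

Lemma measurable_selector_err (d0 : measure_display) (W : measurableType d0)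
    (bh : W -> 'cV[R]_p) (Y : W -> rvec R I) i :
  (forall j, measurable_fun setT (fun w => bh w j 0)) -> measurable_fun setT Y ->
  measurable_fun setT (fun w => selector_err (bh w) i (Y w)).
Proof.
move=> mb mY.
have mYe (e : I) : measurable_fun setT (fun w => Y w e).
  exact: (measurableT_comp (measurable_coord e) mY).
have msel : measurable_fun setT (fun w => selector sig' a s (design (Y w))
    (design (Y w) *m b + sigma *: response (Y w)) (bh w) i).
  apply: measurable_selector => // k.
    by move=> j; under eq_fun do rewrite mxE; exact: mYe.
  under eq_fun do rewrite !mxE.
  apply: measurable_funD; last by apply: measurable_funM.
  apply: measurable_sum => j; under eq_fun do rewrite mxE.
  by apply: measurable_funM.
rewrite /selector_err; case: (eta_supp b i).
  under eq_fun do rewrite eqb_id.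
  exact: measurable_neg.
by under eq_fun do rewrite eqbF_neg negbK.
Qed.

Section conditional.
Variables (bh : 'cV[R]_p) (i : 'I_p).
Hypothesis bhP : norm2 (bh - b) < delta * sigma.

Let S : {set I} := [set e | if e is inl (k, j) then j == i else false]%SET.
Let u (w : T) : 'cV[R]_n := \col_k Z (inl (k, i)) w.

(** With column [i] frozen, the noise part of the normalized statistic is a linear form in the
    redrawn entries. It collects the model noise and the estimation errors of the other
    coordinates. *)
Let coef (w : T) (e : I) : R :=
  match e with
  | inl (k, j) => if j == i then 0 else u w k 0 * (b j 0 - bh j 0) / norm2 (u w)
  | inr k => sigma * u w k 0 / norm2 (u w)
  end.

Let mixed w w' : rvec R I := mix S (joint Z w) (joint Z w').

Let col_mixed w w' : col i (design (mixed w w')) = u w.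
Proof. by apply/matrixP => k j; rewrite !mxE /mixed /mix inE eqxx. Qed.

Let corr_mixed w w' : norm2 (u w) != 0 ->
  residual_corr (design (mixed w w'))
    (design (mixed w w') *m b + sigma *: response (mixed w w')) bh i / norm2 (u w) =
  b i 0 * norm2 (u w) + \sum_e coef w e * Z e w'.
Proof.
move=> u0; apply: (mulIf u0); rewrite divfK// mulrDl -mulrA -expr2 norm2_sqr.
rewrite residual_corrE mulr_sumr big_sumType/=.
rewrite mulrDl mulr_suml mulr_suml sum_pairE/=.
rewrite -!big_split/=; apply: eq_bigr => k _.
have yE j : design (mixed w w') k j = if j == i then u w k 0 else Z (inl (k, j)) w'.
  by rewrite !mxE /mixed /mix inE; case: eqP => // ->.
have rE : response (mixed w w') k 0 = Z (inr k) w' by rewrite !mxE /mixed /mix inE.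
have YE : (design (mixed w w') *m b + sigma *: response (mixed w w')) k 0 =
    \sum_j design (mixed w w') k j * b j 0 + sigma * Z (inr k) w'.
  by rewrite mxE [X in _ + X]mxE rE mxE.
rewrite YE (bigD1 i)//= yE eqxx.
rewrite [X in _ = _ + (X + _)](bigD1 i)//= eqxx !mul0r add0r.
have -> : \sum_(j < p | j != i) design (mixed w w') k j * b j 0 =
    \sum_(j < p | j != i) bh j 0 * design (mixed w w') k j +
    \sum_(j < p | j != i) (b j 0 - bh j 0) * Z (inl (k, j)) w'.
  rewrite -big_split/=; apply: eq_bigr => j ji; rewrite yE (negbTE ji); ring.
have -> : \sum_(j < p | j != i) (if j == i then 0 else u w k 0 * (b j 0 - bh j 0) / norm2 (u w))
     * Z (inl (k, j)) w' * norm2 (u w) =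
     u w k 0 * \sum_(j < p | j != i) (b j 0 - bh j 0) * Z (inl (k, j)) w'.
  rewrite mulr_sumr; apply: eq_bigr => j ji; rewrite (negbTE ji); field; exact: u0.
field; exact: u0.
Qed.

Let v2 : R := sigma ^+ 2 + \sum_(j < p | j != i) (b j 0 - bh j 0) ^+ 2.

Let coef_sqr w : norm2 (u w) != 0 -> \sum_e coef w e ^+ 2 = v2.
Proof.
move=> u0; rewrite big_sumType/=.
rewrite sum_pairE/=.
have -> : \sum_k (sigma * u w k 0 / norm2 (u w)) ^+ 2 = sigma ^+ 2.
  transitivity (\sum_k sigma ^+ 2 / norm2 (u w) ^+ 2 * u w k 0 ^+ 2).
    by apply: eq_bigr => k _; field; exact: u0.
  by rewrite -mulr_sumr -norm2_sqr divfK// expf_neq0.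
rewrite /v2 addrC; congr (_ + _).
have -> : \sum_(j < p | j != i) (b j 0 - bh j 0) ^+ 2 =
   (\sum_(j < p | j != i) (b j 0 - bh j 0) ^+ 2) / norm2 (u w) ^+ 2 * \sum_k u w k 0 ^+ 2.
  by rewrite -norm2_sqr divfK// expf_neq0.
rewrite mulr_sumr; apply: eq_bigr => k _.
rewrite (bigD1 i)//= eqxx expr0n/= add0r.
rewrite -mulrA mulr_suml; apply: eq_bigr => j ji; rewrite (negbTE ji).
field; exact: u0.
Qed.

Let v : R := Num.sqrt v2.

Let v2_gt0 : 0 < v2.
Proof. by rewrite ltr_pwDl ?exprn_gt0// sumr_ge0// => j _; exact: sqr_ge0. Qed.

Let v_lt : v < sig'.
Proof.
have sig'0 : 0 <= sig' by rewrite mulr_ge0 ?sqrtr_ge0// ltW.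
rewrite -(@ltr_pXn2r _ 2)// ?nnegrE ?sqrtr_ge0// sqr_sqrtr ?(ltW v2_gt0)//.
rewrite /sig' exprMn sqr_sqrtr ?addr_ge0 ?sqr_ge0// mulrDr mulr1 /v2 ltrD2l.
apply: (@le_lt_trans _ _ (norm2 (bh - b) ^+ 2)).
  rewrite norm2_sqr [leRHS](bigD1 i)//= -[leLHS]add0r lerD ?sqr_ge0//.
  by apply: ler_sum => j _; rewrite !mxE -sqrrN opprB.
rewrite mulrC -exprMn ltr_pXn2r// ?nnegrE ?norm2_ge0//.
exact: le_trans (norm2_ge0 _) (ltW bhP).
Qed.

Let inner_bound w :
  (P [set w' | selector_err bh i (mixed w w')] <=
   2%:E * normal_prob 0 1 [set y | (err_threshold i (u w) < sig' * y)%R])%E.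
Proof.
have sig'0 : 0 < sig' by rewrite mulr_gt0// sqrtr_gt0 ltr_pwDl// sqr_ge0.
(* When the column vanishes, divisions by zero make the threshold and the statistic 0,
   so nothing is selected. *)
have [u0|u0] := eqVneq (norm2 (u w)) 0.
  have E w' : selector_err bh i (mixed w w') = eta_supp b i.
    by rewrite /selector_err /selector col_mixed u0 /threshold u0 !mulr0 invr0 !mulr0 mul0r addr0 ltxx; case: eta_supp.
  have t0 : threshold sig' a p s (u w) = 0.
    by rewrite /threshold u0 !mulr0 invr0 mul0r !mulr0 addr0.
  under eq_set do rewrite E.
  rewrite /err_threshold t0 u0 mulr0 subrr maxxx if_same.
  (* An active coordinate is then missed with probability 1, which twice the tail at 0 still covers;
     an inactive one is never selected. *)
  have [_|_] := boolP (eta_supp b i).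
    apply: le_trans (normal01_half sig'0).
    by rewrite [X in P X](_ : _ = setT) ?probability_setT//; apply/seteqP; split.
  rewrite [X in P X](_ : _ = set0) ?measure0; last by apply/seteqP; split.
  by rewrite mule_ge0// measure_ge0.
have up : 0 < norm2 (u w) by rewrite lt_neqAle eq_sym u0 norm2_ge0.
pose t := threshold sig' a p s (u w).
pose m := b i 0 * norm2 (u w).
have E w' : selector sig' a s (design (mixed w w'))
    (design (mixed w w') *m b + sigma *: response (mixed w w')) bh i =
    (t < `|m + \sum_e coef w e * Z e w'|).
  rewrite /selector col_mixed -/t; congr (_ < _).
  by rewrite -corr_mixed// normrM normfV (ger0_norm (norm2_ge0 _)) /residual_corr col_mixed.
have v_gt0 : 0 < v by rewrite sqrtr_gt0.
have v0 : v != 0 by rewrite gt_eqF.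
have vv : v ^+ 2 = \sum_(e <- index_enum I) coef w e ^+ 2.
  by rewrite sqr_sqrtr ?ltW// coef_sqr.
have law B : measurable B -> P [set w' | B (\sum_e coef w e * Z e w')] =
    normal_prob 0 1 [set y | B (v * y)].
  move=> mB; rewrite (normal_prob_scale v0 mB).
  exact: (iid_lin iidZ (index_enum_uniq _) v0 vv mB).
have mB : measurable [set x : R | t < `|m + x|].
  rewrite (_ : [set x | _] = (fun x => `|m + x|) @^-1` `]t, +oo[%classic).
    apply: measurable_preimage; last exact: measurable_itv.
    by apply: measurableT_comp => //; exact: measurable_funD.
  by apply/seteqP; split=> y /=; rewrite in_itv/= andbT.
rewrite /err_threshold -/t; have [bi|bi] := boolP (eta_supp b i).
  have -> : [set w' | selector_err bh i (mixed w w')] =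
     [set w' | (~` [set x : R | t < `|m + x|]) (\sum_e coef w e * Z e w')].
    by apply/seteqP; split=> w' /=; rewrite /selector_err E bi eqb_id => /negP.
  rewrite law; last exact: measurableC.
  have -> : [set y | (~` [set x : R | t < `|m + x|]) (v * y)] = [set y | `|m + v * y| <= t].
    by apply/seteqP; split=> y /=; rewrite leNgt => /negP.
  apply: normal01_shifted => //.
  by rewrite /m normrM (ger0_norm (norm2_ge0 _)) ler_wpM2r ?norm2_ge0// bP.2.
have -> : [set w' | selector_err bh i (mixed w w')] =
     [set w' | [set x : R | t < `|m + x|] (\sum_e coef w e * Z e w')].
  by apply/seteqP; split=> w' /=; rewrite /selector_err E (negbTE bi) eqbF_neg negbK.
rewrite law//.
have m0 : m = 0 by move: bi; rewrite negbK /m => /eqP ->; rewrite mul0r.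
have -> : [set y | [set x : R | t < `|m + x|] (v * y)] = [set y | t < `|v * y|].
  by apply/seteqP; split=> y /=; rewrite m0 add0r.
by apply: normal01_two_sided => //; [exact: ltW|exact: threshold_ge0].
Qed.

Lemma selector_err_bound :
  (P [set w | selector_err bh i (joint Z w)] <=
   2%:E * Q [set w | (err_threshold i (\col_k zeta k w) < sig' * eps w)%R])%E.
Proof.
pose H : set (rvec R I) := [set y | selector_err bh i y].
have mH : measurable H.
  rewrite (_ : H = (fun y => selector_err bh i y) @^-1` [set true]).
    apply: measurable_preimage => //.
    by apply: (measurable_selector_err (bh := fun=> bh)).
  by apply/seteqP; split.
rewrite -[leLHS]/(P (joint Z @^-1` H)) (iid_mix S iidZ mH).
have injU : injective (fun k : 'I_n => inl (k, i) : I) by move=> k k' [].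
have iidU := iid_reindex injU iidZ.
rewrite -(cond_tailE iidU iidQ sig' (measurable_err_threshold i)).
have mtail := measurable_cond_tail iidU sig' (measurable_err_threshold i).
rewrite -ge0_integralZl//=.
apply: ge0_le_integral => //=.
- exact: (measurable_mix iidZ S mH).
- exact: measurable_funeM.
- by move=> w _; exact: inner_bound.
Qed.

End conditional.

End selector_error.

Lemma slope_borel_version {R : realType} {n1 n2 p : nat} (A sigma : R) (b : 'cV[R]_p)
    (bhat : 'M[R]_(n1, p) -> 'cV[R]_n1 -> 'cV[R]_p)
    d (T : measurableType d) (P : probability T R)
    (Z : ('I_n1 * 'I_p + 'I_n1)%type -> T -> R) :
  0 < A -> 0 < sigma -> (0 < p)%N -> is_sqrt_slope A (n1 + n2) bhat ->
  iid_std_normal P Z ->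
  exists (bt : rvec R ('I_n1 * 'I_p + 'I_n1)%type -> 'cV[R]_p)
         (N : set (rvec R ('I_n1 * 'I_p + 'I_n1)%type)),
    [/\ forall i, measurable_fun setT (fun x => bt x i 0), iid_null P Z N &
     forall x, ~ N x -> bt x = bhat (design x) (design x *m b + sigma *: response x)].
Proof.
move=> A0 sigma0 p0 bhatP iZ.
case: n1 => [|n1] in bhat Z bhatP iZ *; last exact: (slope_borel b A0 sigma0 p0 bhatP _ iZ).
(* Without first-sample observations the coordinate space is a single point, so [bhat] itself is a
   Borel function of the data. *)
pose bt (x : rvec R ('I_0 * 'I_p + 'I_0)%type) :=
  bhat (design x) (design x *m b + sigma *: response x).
exists bt, set0; split=> //; last by split=> //; rewrite preimage_set0 measure0.
move=> i; rewrite (_ : (fun x => _) = cst (bt (fun=> 0) i 0)); first exact: measurable_cst.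
apply/funext => x; rewrite (_ : x = (fun=> 0))//.
by apply/funext => -[[[]]|[]].
Qed.

Lemma card_set_sum {J : finType} (f : J -> bool) :
  #|[set i | f i]| = (\sum_i f i)%N.
Proof.
rewrite -sum1_card big_mkcond/=; apply: eq_bigr => i _.
have -> : (i \in [set i | f i]) = f i by apply/idP/idP; rewrite inE.
by case: (f i).
Qed.

(** * Summation over coordinates and the two risk bounds *)

Section error_sums.
Context {R : realType} d' (T' : measurableType d') (Q : probability T' R).
Context {n p : nat} (eps : T' -> R) (zeta : 'I_n -> T' -> R).
Variables (s : nat) (sigma a delta : R) (b : 'cV[R]_p).
Hypothesis iidQ : iid_std_normal Q (eps_zeta eps zeta).
Hypothesis a_gt0 : 0 < a.
Hypothesis s_gt0 : (1 <= s)%N.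
Hypothesis sp : (2 * s <= p)%N.
Hypothesis bP : in_Omega s a b.

Let sig' := sigma * Num.sqrt (1 + delta ^+ 2).
Let tail (i : 'I_p) := [set w | err_threshold s sigma a delta b i (\col_k zeta k w) < sig' * eps w].

(** The support of [b] may have fewer than [s] elements, whereas psi weights the active tail by
    exactly [s]. The sum is monotone in the support size because the active tail dominates:
    [threshold_ge] and [threshold_ge0] give that the positive part of [a * norm2 u] minus the
    threshold is at most the threshold. *)
Lemma sum_tails : (\sum_i 2%:E * Q (tail i) <= (2 * psi_of Q eps zeta p s a sig')%:E)%E.
Proof.
pose zv w : 'cV[R]_n := \col_k zeta k w.
pose S1 := [set w | threshold sig' a p s (zv w) < sig' * eps w].
pose S2 := [set w | Num.max (a * norm2 (zv w) - threshold sig' a p s (zv w)) 0 < sig' * eps w].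
have tailE i : tail i = if eta_supp b i then S2 else S1.
  by rewrite /tail /err_threshold; case: (eta_supp b i).
have mS1 : measurable S1.
  rewrite (_ : S1 = (fun w => threshold sig' a p s (zv w) < sig' * eps w) @^-1` [set true]);
    last by apply/seteqP; split.
  apply: measurable_preimage => //; apply: measurable_fun_ltr.
    apply: measurable_threshold => // k; under eq_fun do rewrite mxE.
    exact: (iidQ.1 (Some k)).
  by apply: measurable_funM => //; exact: (iidQ.1 None).
have mS2 : measurable S2.
  rewrite (_ : S2 = (fun w => Num.max (a * norm2 (zv w) - threshold sig' a p s (zv w)) 0
      < sig' * eps w) @^-1` [set true]); last by apply/seteqP; split.
  have mz k : measurable_fun setT (fun w => zv w k 0).
    by under eq_fun do rewrite mxE; exact: (iidQ.1 (Some k)).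
  apply: measurable_preimage => //; apply: measurable_fun_ltr.
    apply: measurable_maxr => //; apply: measurable_funB; last exact: measurable_threshold.
    by apply: measurable_funM => //; exact: measurable_norm2.
  by apply: measurable_funM => //; exact: (iidQ.1 None).
pose q1 := fine (Q S1); pose q2 := fine (Q S2).
have QE i : Q (tail i) = (q1 + (eta_supp b i)%:R * (q2 - q1))%:E.
  rewrite tailE; case: (eta_supp b i).
    by rewrite mul1r subrKC fineK// fin_num_measure.
  by rewrite mul0r addr0 fineK// fin_num_measure.
have q12 : q1 <= q2.
  rewrite fine_le ?fin_num_measure// le_measure ?inE// => w; rewrite /S1 /S2 /=.
  apply: le_lt_trans; rewrite ge_max (threshold_ge0 _ _ a_gt0 s_gt0 sp) andbT.
  have := threshold_ge sigma delta a_gt0 s_gt0 sp (zv w); rewrite -/sig'.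
  by move: (threshold _ _ _ _ _) (a * _) => t x; lra.
under eq_bigr => i _ do rewrite QE -EFinM.
rewrite sumEFin lee_fin -mulr_sumr ler_wpM2l// big_split/= sumr_const card_ord.
rewrite -mulr_suml /psi_of -/zv -/q1 -/q2 natrB; last by apply: leq_trans sp; rewrite leq_pmull.
have -> : (p%:R - s%:R) * q1 + s%:R * q2 = q1 *+ p + s%:R * (q2 - q1).
  by rewrite -mulr_natl; ring.
rewrite lerD2l ler_wpM2r ?subr_ge0// -natr_sum ler_nat.
by apply: leq_trans bP.1; rewrite /l0 card_set_sum.
Qed.

End error_sums.

(** Freezing the first subsample makes the estimate a constant, to which [selector_err_bound]
    applies if it is accurate; otherwise the slice is empty. Bounding the intersection with the good
    event avoids any conditional probability. *)
Lemma iid_selector_err_le {R : realType} d (T : measurableType d) (P : probability T R)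
    d' (T' : measurableType d') (Q : probability T' R) {n1 n2 p s : nat}
    (sigma a delta : R) (b : 'cV[R]_p)
    (Z : ('I_n1 * 'I_p + 'I_n1 + ('I_n2 * 'I_p + 'I_n2))%type -> T -> R)
    (eps : T' -> R) (zeta : 'I_n2 -> T' -> R)
    (bt : rvec R ('I_n1 * 'I_p + 'I_n1)%type -> 'cV[R]_p) (i : 'I_p) :
  iid_std_normal P Z -> iid_std_normal Q (eps_zeta eps zeta) ->
  0 < sigma -> 0 < a -> (1 <= s)%N -> (2 * s <= p)%N -> in_Omega s a b ->
  (forall j, measurable_fun setT (fun x => bt x j 0)) ->
  (P [set w | (norm2 (bt (joint (Z \o inl) w) - b)%R < delta * sigma)%R /\
              selector_err s sigma a delta b (bt (joint (Z \o inl) w)) i (joint (Z \o inr) w)]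
   <= 2%:E * Q [set w | (err_threshold s sigma a delta b i (\col_k zeta k w) <
        sigma * Num.sqrt (1 + delta ^+ 2) * eps w)%R])%E.
Proof.
move=> iZ iQ sigma0 a0 s0 sp bP mbt.
pose I := ('I_n1 * 'I_p + 'I_n1 + ('I_n2 * 'I_p + 'I_n2))%type.
pose H : set (rvec R I) := [set z |
  norm2 (bt (fun e => z (inl e)) - b) < delta * sigma /\
  selector_err s sigma a delta b (bt (fun e => z (inl e))) i (fun e => z (inr e))].
have m1 : measurable_fun setT (fun z : rvec R I => (fun e => z (inl e)) :
    rvec R ('I_n1 * 'I_p + 'I_n1)%type).
  by apply: measurable_rvec => e; exact: (measurable_coord (inl e : I)).
have m2 : measurable_fun setT (fun z : rvec R I => (fun e => z (inr e)) :
    rvec R ('I_n2 * 'I_p + 'I_n2)%type).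
  by apply: measurable_rvec => e; exact: (measurable_coord (inr e : I)).
have mbt' j : measurable_fun setT (fun z : rvec R I => bt (fun e => z (inl e)) j 0).
  exact: (measurableT_comp (mbt j) m1).
have mH : measurable H.
  rewrite (_ : H = (fun z : rvec R I =>
      (norm2 (bt (fun e => z (inl e)) - b) < delta * sigma) &&
      selector_err s sigma a delta b (bt (fun e => z (inl e))) i (fun e => z (inr e)))
      @^-1` [set true]); last by apply/seteqP; split=> z /=; move/andP.
  apply: measurable_preimage => //; apply: measurable_and.
    apply: measurable_fun_ltr => //; apply: measurable_norm2 => j.
    by under eq_fun do rewrite !mxE; apply: measurable_funB.
  exact: (measurable_selector_err s sigma delta b a0 i mbt' m2).
rewrite -[leLHS]/(P (joint Z @^-1` H)).
pose S : {set I} := [set e | if e is inl _ then true else false]%SET.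
apply: (iid_mix_le iZ (S := S) mH); first by rewrite mule_ge0.
move=> w; pose bw := bt (joint (Z \o inl) w).
have E w' : H (mix S (joint Z w) (joint Z w')) =
    (norm2 (bw - b) < delta * sigma /\
     selector_err s sigma a delta b bw i (joint (Z \o inr) w')).
  rewrite /H /=.
  have -> : (fun e => mix S (joint Z w) (joint Z w') (inl e)) = joint (Z \o inl) w.
    by apply/funext => e; rewrite /mix inE.
  have -> : (fun e => mix S (joint Z w) (joint Z w') (inr e)) = joint (Z \o inr) w'.
    by apply/funext => e; rewrite /mix inE.
  by [].
under eq_set do rewrite E.
have [good|bad] := ltP (norm2 (bw - b)) (delta * sigma); last first.
  rewrite [X in P X](_ : _ = set0) ?measure0 ?mule_ge0//.
  by apply/seteqP; split=> w' //= [].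
have injr : injective (inr : 'I_n2 * 'I_p + 'I_n2 -> I) by move=> ? ? [].
have := selector_err_bound (iid_reindex injr iZ) iQ sigma0 a0 s0 sp bP i good.
by congr (P _ <= _)%E; apply/seteqP; split=> w' //= [].
Qed.

Lemma measure_bigsetU_le {R : realType} d (T : measurableType d)
    (mu : {measure set T -> \bar R}) (J : finType) (F : J -> set T) :
  (forall j, measurable (F j)) -> (mu (\big[setU/set0]_j F j) <= \sum_j mu (F j))%E.
Proof.
move=> mF; elim: (index_enum J) => [|j r IH]; first by rewrite !big_nil measure0.
rewrite !big_cons; apply: (le_trans (measureU2 mu (mF j) _)).
  by apply: bigsetU_measurable => i _; exact: mF.
exact: leeD.
Qed.

Theorem theorem2 (R : realType)
  (d : measure_display) (T : measurableType d) (P : probability T R)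
  (d' : measure_display) (T' : measurableType d') (Q : probability T' R)
  (n1 n2 p s : nat) (sigma a A delta C0 C1 C2 : R)
  (X1 : T -> 'M[R]_(n1, p)) (xi1 : T -> 'cV[R]_n1)
  (X2 : T -> 'M[R]_(n2, p)) (xi2 : T -> 'cV[R]_n2)
  (eps : T' -> R) (zeta : 'I_n2 -> T' -> R)
  (bhat : 'M[R]_(n1, p) -> 'cV[R]_n1 -> 'cV[R]_p) :
  0 < sigma -> 0 < a -> 16 + 4 * Num.sqrt 2 <= A ->
  iid_std_normal P (data_family X1 xi1 X2 xi2) ->
  iid_std_normal Q (eps_zeta eps zeta) ->
  is_sqrt_slope A (n1 + n2) bhat ->
  (forall (b : 'cV[R]_p) (i : 'I_p),
     measurable_fun setT (fun w => bhat (X1 w) (X1 w *m b + sigma *: xi1 w) i 0)) ->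
  (* the fact on Square-Root SLOPE with constants C0, C1, C2 *)
  (forall delta' : R, 0 < delta' <= 1 ->
     C0 / delta' ^+ 2 * s%:R * ln (expR 1 * p%:R / s%:R) < n1%:R ->
     forall b : 'cV[R]_p, (l0 b <= s)%N ->
       (P [set w | (delta' * sigma <=
                   norm2 (bhat (X1 w) (X1 w *m b + sigma *: xi1 w) - b))%R]
        <= (C1 * (s%:R / (2 * p%:R)) `^ (C2 * s%:R))%:E)%E) ->
  (1 <= s)%N -> (2 * s <= p)%N -> 0 < delta <= 1 ->
  C0 / delta ^+ 2 * s%:R * ln (expR 1 * p%:R / s%:R) < n1%:R ->
  forall b : 'cV[R]_p, in_Omega s a b ->
  let sig' := sigma * Num.sqrt (1 + delta ^+ 2) in
  let psi := psi_of Q eps zeta p s a sig' in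
  let etahat w := selector sig' a s (X2 w) (X2 w *m b + sigma *: xi2 w)
                    (bhat (X1 w) (X1 w *m b + sigma *: xi1 w)) in
  (\int[P]_w (#|[set i | etahat w i != eta_supp b i]|%:R : R)%:E
     <= (2 * psi + C1 * (s%:R / 2) `^ (C2 * s%:R) * p%:R `^ (1 - C2 * s%:R))%:E)%E
  /\
  (P [set w | exists i, etahat w i != eta_supp b i]
     <= (2 * psi + C1 * (s%:R / 2) `^ (C2 * s%:R) * p%:R `^ (- (C2 * s%:R)))%:E)%E.
Proof.
move=> sigma0 a0 HA iZ iQ bhatP mW slope s0 sp d01 n1C b bP sig' psi etahat.
have A0 : 0 < A by apply: lt_le_trans HA; rewrite ltr_pwDl// mulr_ge0// sqrtr_ge0.
have p0 : (0 < p)%N by apply: leq_trans sp; rewrite muln_gt0.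
have pR : 0 < p%:R :> R by rewrite ltr0n.
pose Z := data_family X1 xi1 X2 xi2.
pose W w := bhat (X1 w) (X1 w *m b + sigma *: xi1 w).
have injl : injective (inl : 'I_n1 * 'I_p + 'I_n1 ->
  ('I_n1 * 'I_p + 'I_n1) + ('I_n2 * 'I_p + 'I_n2)) by move=> ? ? [].
have iZ1 := iid_reindex injl iZ; rewrite -/Z in iZ1.
have design1 w : design (joint (Z \o inl) w) = X1 w.
  by apply/matrixP => i j; rewrite mxE.
have response1 w : response (joint (Z \o inl) w) = xi1 w.
  by apply/matrixP => i j; rewrite mxE ord1.
have design2 w : design (joint (Z \o inr) w) = X2 w.
  by apply/matrixP => i j; rewrite mxE.
have response2 w : response (joint (Z \o inr) w) = xi2 w.
  by apply/matrixP => i j; rewrite mxE ord1.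
have [bt [N [mbt [mN N0] btE]]] := slope_borel_version b A0 sigma0 p0 bhatP iZ1.
pose err i w := selector_err s sigma a delta b (W w) i (joint (Z \o inr) w).
have errE i w : (etahat w i != eta_supp b i) = err i w.
  by rewrite /err /selector_err design2 response2.
have mZ2 : measurable_fun setT (joint (Z \o inr) : T -> rvec R ('I_n2 * 'I_p + 'I_n2)%type).
  by apply: measurable_rvec => e; exact: (iZ.1 (inr e)).
pose E i := [set w | err i w].
have mE i : measurable (E i).
  rewrite (_ : E i = err i @^-1` [set true]); last by apply/seteqP; split.
  apply: measurable_preimage => //.
  exact: (measurable_selector_err s sigma delta b a0 i (mW b) mZ2).
pose bad := [set w | delta * sigma <= norm2 (W w - b)].
have mbad : measurable bad.
  rewrite (_ : bad = (fun w => delta * sigma <= norm2 (W w - b)) @^-1` [set true]);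
    last by apply/seteqP; split.
  apply: measurable_preimage => //; apply: measurable_fun_ler => //.
  apply: measurable_norm2 => j; under eq_fun do rewrite !mxE.
  by apply: measurable_funB => //; exact: mW.
pose c := C2 * s%:R.
pose beta := C1 * (s%:R / (2 * p%:R)) `^ c.
have Pbad : (P bad <= beta%:E)%E by exact: slope bP.1.
(* The assumed bound on the estimator is rewritten in the form of the two remainders: [beta] itself
   for the probability of any error, [p] times [beta] for the expected number of errors. *)
have betaE : beta = C1 * (s%:R / 2) `^ c * p%:R `^ (- c).
  rewrite /beta invfM mulrA powRM ?invr_ge0 ?divr_ge0//.
  by rewrite -(powR_inv1 (ltW pR)) -powRrM mulN1r mulrA.
have pbetaE : p%:R * beta = C1 * (s%:R / 2) `^ c * p%:R `^ (1 - c).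
  rewrite betaE powRD; last by rewrite (gt_eqF pR) implybT.
  by rewrite powRr1// mulrCA.
pose q i := (2%:E * Q [set w | (err_threshold s sigma a delta b i (\col_k zeta k w) <
        sig' * eps w)%R])%E.
have mNZ : measurable (joint (Z \o inl) @^-1` N).
  exact: (measurable_preimage (measurable_joint iZ1) mN).
have good i : (P (E i `\` bad) <= q i)%E.
  have := iid_selector_err_le delta i iZ iQ sigma0 a0 s0 sp bP mbt.
  apply: le_trans.
  set G := [set w | _].
  have mG : measurable G.
    pose btZ w := bt (joint (Z \o inl) w).
    have mbtZ j : measurable_fun setT (fun w => btZ w j 0).
      exact: (measurableT_comp (mbt j) (measurable_joint iZ1)).
    rewrite (_ : G = (fun w => (norm2 (btZ w - b) < delta * sigma) &&
       selector_err s sigma a delta b (btZ w) i (joint (Z \o inr) w)) @^-1` [set true]);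
      last by apply/seteqP; split=> w /=; move/andP.
    apply: measurable_preimage => //; apply: measurable_and.
      apply: measurable_fun_ltr => //; apply: measurable_norm2 => j.
      by under eq_fun do rewrite !mxE; apply: measurable_funB.
    exact: (measurable_selector_err s sigma delta b a0 i mbtZ mZ2).
  (* Off the null set [N] the estimate agrees with its Borel version, so errors on the good event
     lie in [G] up to a null set. *)
  apply: (@le_trans _ _ (P (G `|` joint (Z \o inl) @^-1` N))).
    apply: le_measure; rewrite ?inE; [exact: measurableD|exact: measurableU|].
    move=> w [Eiw nbad]; have [Nw|nN] := pselect (N (joint (Z \o inl) w)); [by right|left].
    have bw := btE _ nN; rewrite design1 response1 in bw.
    by split; rewrite bw -/(W w)// ltNge; apply/negP.
  by apply: (le_trans (measureU2 P mG mNZ)); rewrite [X in (_ + X)%E]N0 adde0.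
have sumq : (\sum_i q i <= (2 * psi)%:E)%E by exact: sum_tails.
split.
  have -> : (\int[P]_w (#|[set i | etahat w i != eta_supp b i]|%:R : R)%:E =
      \sum_i P (E i))%E.
    transitivity (\int[P]_w \sum_i (\1_(E i) w)%:E)%E.
      apply: eq_integral => w _; rewrite sumEFin card_set_sum natr_sum.
      congr EFin; apply: eq_bigr => i _; rewrite errE indicE.
      by congr (nat_of_bool _)%:R; apply/idP/idP; rewrite inE.
    rewrite ge0_integral_sum//.
      by apply: eq_bigr => i _; rewrite integral_indic// setIT.
    by move=> i; apply/measurable_EFinP; exact: measurable_indic.
  rewrite -/c -pbetaE EFinD.
  have -> : ((p%:R * beta)%:E = \sum_(i < p) beta%:E)%E.
    by rewrite sumEFin sumr_const card_ord mulr_natl.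
  (* The bad event is charged once for every coordinate, whence the extra factor [p]. *)
  apply: (@le_trans _ _ (\sum_i (q i + beta%:E))%E); last first.
    by rewrite big_split/= leeD2r.
  apply: lee_sum => i _.
  apply: (@le_trans _ _ (P (E i `\` bad) + P bad)%E); last exact: leeD.
  apply: le_trans (measureU2 P (measurableD (mE i) mbad) mbad).
  apply: le_measure; rewrite ?inE//; first by apply: measurableU => //; exact: measurableD.
  by move=> w Ew; have [|] := pselect (bad w); [right|left].
rewrite -/c -betaE EFinD.
(* For the existence of an error, the union bound is applied only on the good event, so the bad
   event is charged a single time. *)
pose U := \big[setU/set0]_(i < p) (E i `\` bad).
have mU : measurable U by apply: bigsetU_measurable => i _; exact: measurableD.
apply: (@le_trans _ _ (P (U `|` bad))).
  apply: le_measure; rewrite ?inE; [|exact: measurableU|].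
    rewrite (_ : [set w | _] = \big[setU/set0]_(i < p) E i).
      by apply: bigsetU_measurable => i _; exact: mE.
    rewrite -bigcup_seq; apply/seteqP; split=> w /=.
      by move=> [i]; rewrite errE => Ew; exists i => //=; rewrite mem_index_enum.
    by move=> [i _ Ew]; exists i; rewrite errE.
  move=> w /= [i]; rewrite errE => Ew; have [|nb] := pselect (bad w); [by right|left].
  by rewrite /U -bigcup_seq; exists i => /=; rewrite ?mem_index_enum.
apply: (le_trans (measureU2 P mU mbad)); apply: leeD => //.
apply: le_trans sumq; apply: (@le_trans _ _ (\sum_i P (E i `\` bad))%E).
  by apply: measure_bigsetU_le => i; exact: measurableD.
by apply: lee_sum.
Qed.
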